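(* Let $E$ be a Banach lattice and let $T$ be a power-bounded positive operator on $E$. Then the unimodular spectrum of $T$ is cyclic, i.e., if $\lambda \in \sigma(T)$ with $|\lambda| = 1$, then $\lambda^k \in \sigma(T)$ for all $k \in \mathbb{Z}$.
   Context: Banach lattices are taken to be complex (spectra are computed on the complexification if the lattice is real). $T$ is power-bounded if $\sup_{n\in\mathbb{N}} \|T^n\| < \infty$, and positive if $Tx \ge 0$ whenever $x \ge 0$. The unimodular spectrum of $T$ is $\sigma(T) \cap \{\lambda \in \mathbb{C} : |\lambda| = 1\}$. *)

(* Defs.v *)
From HB Require Import structures.
From mathcomp Require Import all_boot all_order all_algebra.
From mathcomp Require Import complex.
From mathcomp Require Import all_classical all_reals all_analysis.

Set Implicit Arguments.
Unset Strict Implicit.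
Unset Printing Implicit Defensive.

Import Order.TTheory GRing.Theory Num.Theory.
Import numFieldNormedType.Exports.

Local Open Scope classical_set_scope.
Local Open Scope ring_scope.
Local Open Scope complex_scope.

(* Real Banach lattices.  The order structures of the library cannot be joined
   with its normed modules (the missing joins would have to lie below
   [Num.NumDomain]), so the mixin carries the order and its lattice operations
   explicitly; they are made into a library lattice just below. *)
HB.mixin Record isBanachLattice (R : realType) E
    of CompleteNormedModule R E := {
  blat_le : rel E ;
  blat_join : E -> E -> E ;
  blat_meet : E -> E -> E ;
  blat_le_refl : reflexive blat_le ;
  blat_le_anti : antisymmetric blat_le ;
  blat_le_trans : transitive blat_le ;
  blat_leUx : forall x y z : E,
    blat_le (blat_join x y) z = blat_le x z && blat_le y z ;
  blat_lexI : forall x y z : E,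
    blat_le x (blat_meet y z) = blat_le x y && blat_le x z ;
  blat_leD2r : forall x y z : E, blat_le x y -> blat_le (x + z) (y + z) ;
  blat_scaler_ge0 : forall (a : R) (x : E),
    0 <= a -> blat_le 0 x -> blat_le 0 (a *: x) ;
  blat_le_norm : forall x y : E,
    blat_le (blat_join x (- x)) (blat_join y (- y)) -> `|x| <= `|y|
}.

#[short(type="banachLatticeType")]
HB.structure Definition BanachLattice (R : realType) :=
  { E of isBanachLattice R E & CompleteNormedModule R E }.

Section BanachLatticeOrder.
Variables (R : realType) (E : banachLatticeType R).

HB.instance Definition _ :=
  Order.Le_isPOrder.Build ring_display (BanachLattice.sort E)
    (@blat_le_refl R E) (@blat_le_anti R E) (@blat_le_trans R E).

Fact blat_meetP (x y z : E) : (x <= blat_meet y z) = (x <= y) && (x <= z).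
Proof. exact: blat_lexI. Qed.

Fact blat_joinP (x y z : E) : (blat_join x y <= z) = (x <= z) && (y <= z).
Proof. exact: blat_leUx. Qed.

HB.instance Definition _ :=
  Order.POrder_MeetJoin_isLattice.Build ring_display (BanachLattice.sort E)
    blat_meetP blat_joinP.

End BanachLatticeOrder.

(* The complex Banach lattice with real part [E]: the pair [(x, y)] stands
   for [x + i y]. *)
Definition complexification (R : realType) (E : banachLatticeType R) : Type :=
  (E * E)%type.

Section Complexification.
Variables (R : realType) (E : banachLatticeType R).
Local Notation EC := (complexification E).

HB.instance Definition _ := GRing.Zmodule.copy EC (E * E)%type.

Definition cplx_scale (a : R[i]) (z : EC) : EC :=
  (complex.Re a *: z.1 - complex.Im a *: z.2,
   complex.Re a *: z.2 + complex.Im a *: z.1).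

Fact cplx_scaleA a b z : cplx_scale a (cplx_scale b z) = cplx_scale (a * b) z.
Proof.
case: a b z => [a a'] [b b'] [x y]; rewrite /cplx_scale /=.
rewrite !scalerBr !scalerDr !scalerA !scalerBl !scalerDl !opprD.
by congr (_, _); rewrite -!addrA; congr (_ + _); rewrite [RHS]addrC -addrA.
Qed.

Fact cplx_scale1 : left_id 1 cplx_scale.
Proof.
by case=> x y; rewrite /cplx_scale /= !scale1r !scale0r subr0 addr0.
Qed.

Fact cplx_scaleDr : right_distributive cplx_scale +%R.
Proof.
move=> a [x y] [x' y']; rewrite /cplx_scale /= !scalerDr opprD.
by congr (_, _); rewrite addrACA.
Qed.

Fact cplx_scaleDl z : {morph cplx_scale^~ z : a b / a + b}.
Proof.
case: z => x y [a a'] [b b']; rewrite /cplx_scale /= !scalerDl opprD.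
by congr (_, _); rewrite addrACA.
Qed.

HB.instance Definition _ := GRing.Zmodule_isLmodule.Build R[i] EC
  cplx_scaleA cplx_scale1 cplx_scaleDr cplx_scaleDl.

Definition cplx_ge0 (z : EC) : Prop := z.2 = 0 /\ 0 <= z.1.

(* |x + i y| = sup_t ((cos t) x + (sin t) y).  This supremum exists in every
   Banach lattice, so the default value of [supremum] is never used. *)
Definition cplx_modulus (z : EC) : E :=
  supremum 0 [set cos t *: z.1 + sin t *: z.2 | t in [set: R]].

Definition cplx_norm (z : EC) : R := `|cplx_modulus z|.

Definition op_norm (f : EC -> EC) : \bar R :=
  ereal_sup [set (cplx_norm (f z))%:E | z in [set z | cplx_norm z <= 1]].

Definition positive_op (T : EC -> EC) : Prop :=
  forall z, cplx_ge0 z -> cplx_ge0 (T z).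

(* As [n = 1] is included, this entails that [T] is bounded. *)
Definition power_bounded (T : EC -> EC) : Prop :=
  (ereal_sup [set op_norm (iter n T) | n in [set: nat]] < +oo)%E.

Definition resolvent_set (T : EC -> EC) : set R[i] :=
  [set lam | exists S : {linear EC -> EC},
     [/\ (op_norm S < +oo)%E,
         forall z, S (lam *: z - T z) = z &
         forall z, lam *: S z - T (S z) = z]].

Definition spectrum (T : EC -> EC) : set R[i] := ~` resolvent_set T.

End Complexification.

(* Main.v *)
From HB Require Import structures.
Require Import Defs.
From mathcomp Require Import all_boot all_order all_algebra.
From mathcomp Require Import complex.
From mathcomp Require Import all_classical all_reals all_analysis.
From mathcomp Require Import ring lra.

Set Implicit Arguments.
Unset Strict Implicit.
Unset Printing Implicit Defensive.

Import Order.TTheory GRing.Theory Num.Theory.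
Import numFieldNormedType.Exports.
Import ComplexField.Normc.

Local Open Scope classical_set_scope.
Local Open Scope ring_scope.
Local Open Scope complex_scope.

(** Write [|z|] for the modulus of [z = x + i y] and let [M] bound the norms of
    all powers of [T].  A positive [T] acts as [P] on real and imaginary parts,
    and [|T z| <= P |z|].

    Suppose first that [z] is a nonzero eigenvector, [T z = lam z], and that
    [P |z| = |z|].  On the ideal generated by [u = |z|], which is a space of
    continuous functions on a compact set with [u] as constant [1], the vector
    [z] is a circle-valued function [h] and [P] is a Markov operator.  At a point
    [s] it averages [h] over a probability measure to the value [lam h s] of
    modulus [1], so [h] is almost everywhere equal to [lam h s] and hence [h ^ k]
    averages to [lam ^ k * h s ^ k]: [lam ^ k] is an eigenvalue, with eigenvector
    [u h ^ k].  Three obstacles remain, and all are removed quantitatively, so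
    that neither function representations nor ultrapowers nor invariant
    functionals occur.

    The functional calculus.  The averaging argument needs [h ^ k] only through
    the chord estimate
    [|h ^ k - c ^ k| <= |k| |h - c| <= |k| (t/2 + (1/t) (1 - Re (conj c h)))],
    for [c] on the circle and [t > 0].  Its right-hand side is affine in [h], so it
    makes sense in any Banach lattice ([gap]) and is transported by [P].  A vector
    [v] with [|v - c ^ k u| <= 2 |k| gap c] for every [c] exists because its real
    and imaginary parts are suprema of totally bounded families ([approx_power]).
    Applying [T] to this estimate, comparing it with the estimate at
    [conj lam c], and taking the supremum over [c], which turns
    [Re (conj c z)] into [|z|], gives [T v = lam ^ k v] up to [2 |k| t u] and up to
    multiples of [|T z - lam z|] and [|P u - u|] ([defect_le]).

    The eigenvector.  On the unit circle the resolvent set of [T] contains every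
    point at which [lam - T] is bounded below ([bounded_below_resolvent]), so a
    spectral value has approximate eigenvectors.  For these, [P |z| - |z|] need
    not be small, but it is almost positive and is annihilated in the limit by
    the Cesaro means [A] of [P]; smallness is therefore measured by the seminorm
    [w |-> norm (A |w|)], which remains large at [z] ([almost_fixed_modulus]).

    The resolvent.  If [mu = lam ^ k] were in the resolvent set, a bounded right
    inverse [S] of [mu - T] need not be continuous for that seminorm.  But
    [x = v - e mu S v] satisfies
    [((1 + e) mu - T) x = (mu v - T v) - (e mu) ^ 2 S v], and a Neumann series
    estimate in the lattice bounds [A |x|] by [M / e] times the mean of the
    modulus of the right-hand side ([subeigen_bound]).  The perturbation is
    quadratic in [e], the loss only [1 / e], so the seminorm of [v] is at most
    [M / e] times that of [mu v - T v], plus [O(e)] ([resolvent_mean_bound]);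
    this is absurd for the vectors [v] above. *)

(** * Linear identities in modules *)

(** Vector inequalities below are certified by nonnegative combinations of
    hypotheses, which leaves identities between linear combinations of vectors.
    They are decided by reflection: [lin_setup] reifies both sides over their
    list of atoms and leaves one scalar equation per atom. *)
Inductive lexpr (R : Type) :=
  LVar of nat | LZero | LAdd of lexpr R & lexpr R | LOpp of lexpr R
| LScale of R & lexpr R.
Arguments LVar {R}. Arguments LZero {R}.

Fixpoint leval (R : pzRingType) (V : lmodType R) (env : seq V) (e : lexpr R) :=
  match e with
  | LVar i => nth 0 env i
  | LZero => 0
  | LAdd e1 e2 => leval env e1 + leval env e2
  | LOpp e1 => - leval env e1
  | LScale a e1 => a *: leval env e1
  end.

Fixpoint lcoef (R : pzRingType) (e : lexpr R) (i : nat) : R :=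
  match e with
  | LVar j => if eqn i j then 1 else 0
  | LZero => 0
  | LAdd e1 e2 => lcoef e1 i + lcoef e2 i
  | LOpp e1 => - lcoef e1 i
  | LScale a e1 => a * lcoef e1 i
  end.

Fixpoint same_coefs (R : pzRingType) (e1 e2 : lexpr R) (n : nat) : Prop :=
  if n is m.+1 then lcoef e1 m = lcoef e2 m /\ same_coefs e1 e2 m else True.

Lemma leval_sum (R : pzRingType) (V : lmodType R) (env : seq V) (e : lexpr R) :
  leval env e = \sum_(i < size env) lcoef e i *: nth 0 env i.
Proof.
elim: e => [j||e1 IH1 e2 IH2|e1 IH1|a e1 IH1] /=.
- have [jlt|jge] := ltnP j (size env); last first.
    rewrite nth_default // big1 // => i _; case: eqnP => [ij|_].
      by move: (ltn_ord i); rewrite ij ltnNge jge.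
    by rewrite scale0r.
  rewrite (bigD1 (Ordinal jlt)) //= (introT eqnP erefl) scale1r big1 ?addr0 // => i.
  case: eqnP => [ij|_ _]; last by rewrite scale0r.
  by move/eqP; case; apply: val_inj.
- by rewrite big1 // => i _; rewrite scale0r.
- by rewrite IH1 IH2 -big_split /=; apply: eq_bigr => i _; rewrite scalerDl.
- by rewrite IH1 -sumrN; apply: eq_bigr => i _; rewrite scaleNr.
- by rewrite IH1 scaler_sumr; apply: eq_bigr => i _; rewrite scalerA.
Qed.

Lemma leval_eq (R : pzRingType) (V : lmodType R) (env : seq V)
    (e1 e2 : lexpr R) :
  same_coefs e1 e2 (size env) -> leval env e1 = leval env e2.
Proof.
rewrite !leval_sum => h; apply: eq_bigr => i _; congr (_ *: _).
elim: (size env) (nat_of_ord i) (ltn_ord i) h => [//|n IH] j /=.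
by rewrite ltnS leq_eqVlt => /orP[/eqP -> []//|jn [_ h]]; exact: IH.
Qed.

Ltac lin_head t := lazymatch t with ?f _ => lin_head f | _ => t end.

(** Atoms are compared up to conversion, since the same vector can reach a goal
    through different structure instances; unification is attempted only when
    the head constants agree, which keeps failing comparisons cheap. *)
Ltac lin_same x y :=
  match goal with
  | _ =>
    let _ := match goal with
             | _ => first [ constr_eq x y
                          | let f := lin_head x in let g := lin_head y in
                            constr_eq f g; unify x y ]
             end in
    constr:(true)
  | _ => constr:(false)
  end.

Ltac lin_insert x env :=
  lazymatch env with
  | cons ?y ?l =>
    let same := lin_same x y in
    lazymatch same with
    | true => env
    | false => let l' := lin_insert x l in constr:(cons y l')
    end
  | nil => constr:(cons x nil)
  end.

Ltac lin_index x env :=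
  lazymatch env with
  | cons ?y ?l =>
    let same := lin_same x y in
    lazymatch same with
    | true => constr:(O)
    | false => let i := lin_index x l in constr:(S i)
    end
  end.

Ltac lin_atoms t env :=
  lazymatch t with
  | @Algebra.add _ ?x ?y => let env' := lin_atoms x env in lin_atoms y env'
  | @Algebra.opp _ ?x => lin_atoms x env
  | @GRing.scale _ _ _ ?x => lin_atoms x env
  | @Algebra.zero _ => env
  | _ => lin_insert t env
  end.

Ltac lin_reify R t env :=
  lazymatch t with
  | @Algebra.add _ ?x ?y =>
    let e1 := lin_reify R x env in let e2 := lin_reify R y env in
    constr:(@LAdd R e1 e2)
  | @Algebra.opp _ ?x => let e1 := lin_reify R x env in constr:(@LOpp R e1)
  | @GRing.scale _ _ ?a ?x =>
    let e1 := lin_reify R x env in constr:(@LScale R a e1)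
  | @Algebra.zero _ => constr:(@LZero R)
  | _ => let i := lin_index t env in constr:(@LVar R i)
  end.

Ltac lin_setup R V :=
  lazymatch goal with
  | |- @eq ?T ?x ?y =>
    let env0 := constr:(@nil T) in
    let env1 := lin_atoms x env0 in
    let env := lin_atoms y env1 in
    let e1 := lin_reify R x env in
    let e2 := lin_reify R y env in
    apply: (@leval_eq R V env e1 e2); cbn [same_coefs lcoef size eqn];
    repeat split
  end.

(** * Order and norm in a Banach lattice *)

Section Order.
Variables (R : realType) (E : banachLatticeType R).
Implicit Types (x y z : E) (a b : R).
Local Ltac lin := lin_setup R E; ring.

Lemma blat_subr_ge0 x y : (0 <= y - x) = (x <= y).
Proof.
apply/idP/idP => h; last by rewrite -(subrr x); apply: blat_leD2r.
by rewrite -[x]add0r -[y](subrK x); apply: blat_leD2r.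
Qed.

Lemma blat_addr_ge0 x y : 0 <= x -> 0 <= y -> 0 <= x + y.
Proof.
move=> x0 y0; apply: (le_trans y0); rewrite -{1}[y]add0r.
exact: blat_leD2r.
Qed.

Lemma blat_scale_ge0 a x : 0 <= a -> 0 <= x -> 0 <= a *: x.
Proof. exact: blat_scaler_ge0. Qed.

(** Rules for deriving an inequality from others by exhibiting the multipliers;
    the last premise is a linear identity. *)
Lemma le_lin1 a x1 y1 x y : x1 <= y1 -> 0 <= a ->
  y - x = a *: (y1 - x1) -> x <= y.
Proof.
move=> h a0 e; rewrite -blat_subr_ge0 e.
by apply: blat_scale_ge0 => //; rewrite blat_subr_ge0.
Qed.

Lemma le_lin2 a b x1 y1 x2 y2 x y : x1 <= y1 -> x2 <= y2 ->
  0 <= a -> 0 <= b ->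
  y - x = a *: (y1 - x1) + b *: (y2 - x2) -> x <= y.
Proof.
move=> h1 h2 a0 b0 e; rewrite -blat_subr_ge0 e.
by apply: blat_addr_ge0; apply: blat_scale_ge0 => //; rewrite blat_subr_ge0.
Qed.

Lemma blat_leD x1 x2 y1 y2 : x1 <= y1 -> x2 <= y2 -> x1 + x2 <= y1 + y2.
Proof. by move=> h1 h2; apply: (le_lin2 h1 h2 ler01 ler01); lin. Qed.

Lemma blat_leZ a x y : 0 <= a -> x <= y -> a *: x <= a *: y.
Proof. by move=> a0 h; apply: (le_lin1 h a0); lin. Qed.

Definition vabs x : E := (x `|` - x)%O.

Lemma vabs_le x y : (vabs x <= y) = (x <= y) && (- x <= y).
Proof. by rewrite leUx. Qed.

Lemma le_vabs x : x <= vabs x. Proof. exact: leUl. Qed.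
Lemma leN_vabs x : - x <= vabs x. Proof. exact: leUr. Qed.

Lemma vabs_ge0 x : 0 <= vabs x.
Proof.
have h : 0 <= 2^-1 :> R by rewrite invr_ge0.
by apply: (le_lin2 (le_vabs x) (leN_vabs x) h h); lin_setup R E; field.
Qed.

Lemma blat_norm_le x y : x <= y -> - x <= y -> `|x| <= `|y|.
Proof.
move=> h1 h2; apply: blat_le_norm; change (is_true (vabs x <= vabs y)); rewrite vabs_le.
by rewrite !(le_trans _ (le_vabs y)).
Qed.

Lemma vabs_norm x : `|vabs x| = `|x|.
Proof.
apply/eqP; rewrite eq_le; apply/andP; split; last first.
  by apply: blat_norm_le; [exact: le_vabs | exact: leN_vabs].
apply: blat_le_norm.
change (is_true (vabs (vabs x) <= vabs x)); rewrite vabs_le lexx /=.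
by apply: (le_lin1 (vabs_ge0 x) (ler0n _ 2)); lin.
Qed.

Lemma blat_norm_ge0_le x y : 0 <= x -> x <= y -> `|x| <= `|y|.
Proof.
move=> x0 xy; apply: blat_norm_le => //.
by apply: (le_lin2 x0 xy (ler0n _ 2) ler01); lin.
Qed.

Lemma vabs_ge0_id x : 0 <= x -> vabs x = x.
Proof.
move=> x0; apply/eqP; rewrite eq_le le_vabs vabs_le lexx /= andbT.
by apply: (le_lin1 x0 (ler0n _ 2)); lin.
Qed.

(** The negative part of [x] is dominated by [|x - y|] for every [y >= 0], so its
    norm is at most the distance from [x] to the cone. *)
Lemma blat_ge0_closed x :
  (forall e : R, 0 < e -> exists2 y : E, 0 <= y & `|x - y| <= e) -> 0 <= x.
Proof.
move=> h; set n : E := (- x `|` 0)%O.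
have nn : `|n| = 0.
  apply/eqP; rewrite eq_le normr_ge0 andbT; apply/ler_addgt0Pr => e e0.
  rewrite add0r; have [y y0 xy] := h e e0.
  apply: le_trans xy; rewrite -(vabs_norm (x - y)); apply: blat_norm_ge0_le.
    by rewrite /n leUr.
  rewrite /n leUx vabs_ge0 andbT.
  by apply: (le_lin2 (leN_vabs (x - y)) y0 ler01 ler01); lin.
have : - x <= n by rewrite /n leUl.
move/normr0_eq0: nn => -> /le_lin1; apply; first exact: ler01.
lin.
Qed.

Lemma blat_le_closed x y :
  (forall e : R, 0 < e -> exists2 z : E, x <= z & `|y - z| <= e) -> x <= y.
Proof.
move=> h; rewrite -blat_subr_ge0; apply: blat_ge0_closed => e /h[z xz yz].
exists (z - x); first by rewrite blat_subr_ge0.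
by have -> : y - x - (z - x) = y - z by lin.
Qed.

Lemma blat_ge_closed x y :
  (forall e : R, 0 < e -> exists2 z : E, z <= y & `|x - z| <= e) -> x <= y.
Proof.
move=> h; rewrite -blat_subr_ge0; apply: blat_ge0_closed => e /h[z xz yz].
exists (y - z); first by rewrite blat_subr_ge0.
by have -> : y - x - (y - z) = - (x - z) by [lin]; rewrite normrN.
Qed.

End Order.

(** * Suprema of totally bounded sets *)

Lemma div_natS_small (R : realType) (C e : R) : 0 < e ->
  exists n : nat, forall p, (n <= p)%N -> C / p.+1%:R <= e.
Proof.
move=> e0; have C1 : 0 < `|C| + 1 by rewrite ltr_wpDl.
have [k] := ltr_add_invr (divr_gt0 e0 C1); rewrite add0r => hk.
exists k => p kp; rewrite ler_pdivrMr ?ltr0n //.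
have := ltW hk; rewrite ler_pdivlMr // mulrC ler_pdivrMr ?ltr0n // => h.
have : k.+1%:R <= p.+1%:R :> R by rewrite ler_nat.
move=> /(ler_wpM2l (ltW e0)); apply: le_trans; apply: le_trans h.
by rewrite (le_trans (ler_norm _)) // lerDl.
Qed.

(** Completeness in a form that avoids filters: the harmonic rate is the one that
    nets of mesh [1 / n.+1] provide. *)
Lemma harmonic_cauchy_lim (R : realType) (V : completeNormedModType R)
    (u : nat -> V) (C : R) : 0 <= C ->
  (forall n p, `|u n - u p| <= C / n.+1%:R + C / p.+1%:R) ->
  exists l, forall n, `|u n - l| <= C / n.+1%:R.
Proof.
move=> C0 hu.
have /cauchy_cvgP cv : cauchy (u @ \oo).
  apply: cauchy_exP => e e0.
  have [N hN] := @div_natS_small R C (e / 3) (divr_gt0 e0 (ltr0n _ 3)).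
  exists (u N); exists N => // p /= Np.
  rewrite -ball_normE /=; apply: (le_lt_trans (hu N p)).
  move: (hN _ Np) (hN _ (leqnn N)) e0.
  by move: (C / N.+1%:R) (C / p.+1%:R) => x y; lra.
exists (lim (u @ \oo)) => n.
apply/ler_addgt0Pr => e e0.
have e20 : 0 < e / 2 by rewrite divr_gt0.
have [N hN] := div_natS_small C e20.
have /cvgrPdist_le /(_ _ e20) [N' _ hN'] := cv.
set p := maxn N N'.
have h1 := hN p (leq_maxl _ _); have h2 := hN' p (leq_maxr _ _).
rewrite /= in h2.
have := ler_distD (u p) (u n) (lim (u @ \oo)).
move: (hu n p) h1 h2; rewrite (distrC (lim _)).
by move: (C / n.+1%:R) (C / p.+1%:R) => x y; lra.
Qed.

Section Suprema.
Variables (R : realType) (E : banachLatticeType R).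
Local Ltac lin := lin_setup R E; ring.

(** The value at the empty sequence is arbitrary: a nonzero Banach lattice has no
    least element. *)
Definition finite_join (s : seq E) : E :=
  if s is x :: s' then foldr (fun a b => (a `|` b)%O) x s' else 0.

Lemma finite_join_ub (s : seq E) x : x \in s -> x <= finite_join s.
Proof.
case: s => [//|y s] /=; elim: s x => [|a s IH] x /=.
  by rewrite inE => /eqP ->.
rewrite !inE => /or3P[/eqP->|/eqP->|xs].
- by rewrite (le_trans (IH y _)) ?mem_head // leUr.
- exact: leUl.
- by rewrite (le_trans (IH x _)) ?inE ?xs ?orbT // leUr.
Qed.

Lemma finite_join_le (s : seq E) y : s != [::] ->
  (forall x, x \in s -> x <= y) -> finite_join s <= y.
Proof.
case: s => [//|x s] _ /=; elim: s => [|a s IH] /= h.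
  by apply: h; rewrite inE.
rewrite leUx h ?inE ?eqxx ?orbT //=; apply: IH => z.
by rewrite inE => /orP[] zs; apply: h; rewrite !inE zs ?orbT.
Qed.

(** A Banach lattice need not be Dedekind complete, but the joins of finer and
    finer finite nets form a Cauchy sequence when the mesh is measured by
    multiples of a fixed vector [d]. *)
Lemma supremums_totally_bounded (A : set E) (d : E) : 0 <= d -> A !=set0 ->
  (forall n : nat, exists s : seq E, (forall x, x \in s -> A x) /\
     forall a, A a -> exists2 b, b \in s & a <= b + n.+1%:R^-1 *: d) ->
  supremums A !=set0.
Proof.
move=> d0 [a0 Aa0] /choice[s hs].
have sn0 n : s n != [::].
  by have [_ /(_ _ Aa0)[b]] := hs n; case: (s n).
pose m n := finite_join (s n).
have Am a n : A a -> a <= m n + n.+1%:R^-1 *: d.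
  have [_ h] := hs n; move=> /h[b bs ab].
  by apply: (le_lin2 ab (finite_join_ub bs) ler01 ler01); rewrite /m; lin.
have mm n p : m n <= m p + p.+1%:R^-1 *: d.
  by apply: finite_join_le => // x xs; apply: Am; have [h _] := hs n; apply: h.
have inv0 n : 0 <= n.+1%:R^-1 :> R by rewrite invr_ge0 ler0n.
have dist n p : `|m n - m p| <= `|d| / n.+1%:R + `|d| / p.+1%:R.
  have -> : `|d| / n.+1%:R + `|d| / p.+1%:R =
      `|(n.+1%:R^-1 + p.+1%:R^-1) *: d|.
    by rewrite normrZ ger0_norm ?addr_ge0 // mulrDl ![_ * `|d|]mulrC.
  apply: blat_norm_le.
    by apply: (le_lin2 (mm n p) d0 ler01 (inv0 n)); lin.
  by apply: (le_lin2 (mm p n) d0 ler01 (inv0 p)); lin.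
have [l hl] := harmonic_cauchy_lim (normr_ge0 d) dist.
exists l; split=> [a Aa|y hy].
  apply: blat_le_closed => e e0.
  have e20 : 0 < e / 2 by rewrite divr_gt0.
  have [n /(_ n (leqnn n)) hn] := div_natS_small `|d| e20.
  exists (m n + n.+1%:R^-1 *: d); first exact: Am.
  have -> : l - (m n + n.+1%:R^-1 *: d) = - (m n - l) - n.+1%:R^-1 *: d by lin.
  apply: (le_trans (ler_normB _ _)).
  rewrite normrN normrZ ger0_norm // [_ * `|d|]mulrC.
  by move: (hl n) hn; move: (`|d| / n.+1%:R) => x; lra.
apply: blat_ge_closed => e e0.
have [n /(_ n (leqnn n)) hn] := div_natS_small `|d| e0.
exists (m n); last by rewrite distrC (le_trans (hl n)).
by apply: finite_join_le => // x xs; apply: hy; have [h _] := hs n; apply: h.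
Qed.

End Suprema.

(** * The unit circle *)

Section Circle.
Variable R : realType.
Implicit Types (b c : R[i]) (r : R).

Lemma normc_sqr c : normc c ^+ 2 = complex.Re c ^+ 2 + complex.Im c ^+ 2.
Proof. by case: c => a b; rewrite /= sqr_sqrtr // addr_ge0 // sqr_ge0. Qed.

Lemma normc_ge0 c : 0 <= normc c. Proof. by case: c => a b; apply: sqrtr_ge0. Qed.

Lemma normc_le c r : 0 <= r ->
  (normc c <= r) = (complex.Re c ^+ 2 + complex.Im c ^+ 2 <= r ^+ 2).
Proof. by move=> r0; rewrite -normc_sqr ler_sqr ?nnegrE ?normc_ge0. Qed.

Lemma Re_le_normc c : `|complex.Re c| <= normc c.
Proof.
rewrite -ler_sqr ?nnegrE ?normc_ge0 // normc_sqr real_normK ?num_real //.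
by rewrite lerDl sqr_ge0.
Qed.

Lemma Im_le_normc c : `|complex.Im c| <= normc c.
Proof.
rewrite -ler_sqr ?nnegrE ?normc_ge0 // normc_sqr real_normK ?num_real //.
by rewrite lerDr sqr_ge0.
Qed.

Lemma normc1P c : normc c = 1 <-> complex.Re c ^+ 2 + complex.Im c ^+ 2 = 1.
Proof.
rewrite -normc_sqr; split=> [->|]; first by rewrite expr1n.
move=> h; apply/eqP.
by rewrite -(@eqrXn2 _ 2) ?normc_ge0 // h expr1n.
Qed.

Lemma circle_param c : normc c = 1 ->
  exists t, cos t = complex.Re c /\ sin t = complex.Im c.
Proof.
move=> c1; have /normc1P e := c1.
have hRe : -1 <= complex.Re c <= 1.
  by rewrite -ler_norml -c1 Re_le_normc.
have hs : Num.sqrt (1 - complex.Re c ^+ 2) = `|complex.Im c|.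
  by rewrite -e addrC addKr sqrtr_sqr.
have hc : cos (acos (complex.Re c)) = complex.Re c by rewrite acosK // in_itv.
have hsin := sin_acos hRe.
have [im0|im0] := leP 0 (complex.Im c).
  by exists (acos (complex.Re c)); rewrite hc hsin hs ger0_norm.
exists (- acos (complex.Re c)).
by rewrite cosN sinN hc hsin hs ltr0_norm // opprK.
Qed.

(** Pigeonhole: a grid of mesh [1/K], one point of the circle being chosen in
    each cell that meets it. *)
Lemma circle_net (n : nat) : exists s : seq R[i],
  (forall c, c \in s -> normc c = 1) /\
  forall c, normc c = 1 -> exists2 b, b \in s & normc (c - b) <= n.+1%:R^-1.
Proof.
pose K : R := (2 * n.+1)%:R.
have K0 : 0 < K by rewrite ltr0n.
pose cell c := (Num.truncn (K * (complex.Re c + 1)),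
                Num.truncn (K * (complex.Im c + 1))).
pose g p := xget 1 [set c | normc c = 1 /\ cell c = p].
pose N := (4 * n.+1).+1.
(* The coordinates, shifted by 1, lie in [0, 2], whence the cell numbers lie in
   [0, 2K]. *)
exists [seq g (i, j) | i <- iota 0 N, j <- iota 0 N]; split.
  move=> c /allpairsP[[i j] /= [_ _ ->]]; rewrite /g.
  by case: xgetP => [? _ []//|_]; rewrite normc1.
move=> c c1.
have trunc_bound (x : R) : `|x| <= 1 -> 0 <= K * (x + 1) /\
    (Num.truncn (K * (x + 1)) < N)%N.
  rewrite ler_norml => /andP[x1 x2].
  have h0 : 0 <= K * (x + 1) by rewrite mulr_ge0 ?(ltW K0) //; lra.
  split=> //; rewrite ltnS -(ler_nat R).
  have [+ _] := andP (truncn_itv h0); move/le_trans; apply.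
  have -> : (4 * n.+1)%:R = K * 2 :> R by rewrite /K -natrM mulnAC.
  by rewrite ler_pM2l //; lra.
have [r0 rN] : 0 <= K * (complex.Re c + 1) /\ ((cell c).1 < N)%N.
  by apply: trunc_bound; rewrite -c1 Re_le_normc.
have [i0 iN] : 0 <= K * (complex.Im c + 1) /\ ((cell c).2 < N)%N.
  by apply: trunc_bound; rewrite -c1 Im_le_normc.
exists (g (cell c)).
  apply/allpairsP; exists (cell c); rewrite !mem_iota /=.
  by split=> //; case: (cell c).
have close (x y : R) : 0 <= K * (x + 1) -> `|y| <= 1 ->
    Num.truncn (K * (x + 1)) = Num.truncn (K * (y + 1)) ->
    (x - y) ^+ 2 <= K^-1 ^+ 2.
  move=> x0 /trunc_bound[y0 _] e.
  have /andP[x1 x2] := truncn_itv x0; have /andP[y1 y2] := truncn_itv y0.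
  rewrite -real_normK ?num_real // ler_sqr ?nnegrE ?invr_ge0 ?(ltW K0) //.
  rewrite -[K^-1]mul1r ler_pdivlMr // -[X in _ * X]gtr0_norm // -normrM.
  rewrite e in x1 x2; move: x1 x2 y1 y2; rewrite -natr1 ler_norml.
  move: (Num.truncn _)%:R => t *; apply/andP; split; lra.
rewrite /g; case: xgetP => [b _ [b1 bc]|/(_ c)[]//].
rewrite normc_le ?invr_ge0 ?ler0n //.
case: bc => e1 e2.
have hr : (complex.Re c - complex.Re b) ^+ 2 <= K^-1 ^+ 2.
  by apply: close r0 _ (esym e1); rewrite -b1 Re_le_normc.
have hi : (complex.Im c - complex.Im b) ^+ 2 <= K^-1 ^+ 2.
  by apply: close i0 _ (esym e2); rewrite -b1 Im_le_normc.
have -> : complex.Re (c - b) = complex.Re c - complex.Re b.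
  by case: (c) (b) => [? ?] [? ?].
have -> : complex.Im (c - b) = complex.Im c - complex.Im b.
  by case: (c) (b) => [? ?] [? ?].
apply: (le_trans (lerD hr hi)).
rewrite /K natrM invfM exprMn -mulr2n -mulrnAl.
have := sqr_ge0 (n.+1%:R^-1 : R); move: (n.+1%:R^-1 ^+ 2) => t; lra.
Qed.
End Circle.

(** * The modulus on the complexification *)

Section Modulus.
Variables (R : realType) (E : banachLatticeType R).
Local Notation EC := (complexification E).
Implicit Types (x y : E) (z w : EC) (a r : R) (b c d : R[i]).
Local Ltac lin := lin_setup R E; ring.

(** Lipschitz families over the circle are totally bounded in the sense of
    [supremums_totally_bounded].  Both the modulus and the approximate powers
    are such suprema. *)
Lemma circle_sup (F : R[i] -> E) (e : E) : 0 <= e ->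
  (forall b c, normc b = 1 -> normc c = 1 -> F c <= F b + normc (c - b) *: e) ->
  exists m, (forall c, normc c = 1 -> F c <= m) /\
    forall y, (forall c, normc c = 1 -> F c <= y) -> m <= y.
Proof.
move=> e0 hF.
have [] := @supremums_totally_bounded R E [set F c | c in [set c | normc c = 1]] e.
- exact: e0.
- by exists (F 1), 1 => //; exact: normc1.
- move=> n; have [s [s1 s2]] := circle_net R n.
  exists (map F s); split=> [_ /mapP[c cs ->]|_ [c /= c1 <-]].
    by exists c => //=; apply: s1.
  have [b bs cb] := s2 _ c1; exists (F b); first exact: map_f.
  have hb : normc (c - b) *: e <= n.+1%:R^-1 *: e.
    by apply: (@le_lin1 _ _ (n.+1%:R^-1 - normc (c - b)) _ _ _ _ e0);
      [rewrite subr_ge0 | lin].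
  by apply: (le_lin2 (hF b c (s1 _ bs) c1) hb ler01 ler01); lin.
- move=> m [ub lb]; exists m; split=> [c c1|y hy].
    by apply: ub; exists c.
  by apply: lb => _ [c c1 <-]; apply: hy.
Qed.

(** The real part of [conj c z]; on the circle these vectors are exactly the
    members of the family that defines the modulus. *)
Definition rpart c z : E := complex.Re c *: z.1 + complex.Im c *: z.2.

Lemma rpartD c z w : rpart c (z + w) = rpart c z + rpart c w.
Proof. by rewrite /rpart /=; lin. Qed.

Lemma rpartZ c d z : rpart c (d *: z) = rpart (conjc d * c) z.
Proof. by case: c d => [c1 c2] [d1 d2]; rewrite /rpart /=; lin. Qed.

Lemma rpart_vabs c z r : normc c <= r ->
  rpart c z <= r *: (vabs z.1 + vabs z.2).
Proof.
have part (t : R) (x : E) : `|t| <= r -> t *: x <= r *: vabs x.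
  rewrite ler_norml => /andP[h1 h2].
  have h3 : 0 <= (r + t) / 2 by lra.
  have h4 : 0 <= (r - t) / 2 by lra.
  by apply: (le_lin2 (le_vabs x) (leN_vabs x) h3 h4); lin_setup R E; field.
move=> cr.
have h1 := part _ z.1 (le_trans (Re_le_normc c) cr).
have h2 := part _ z.2 (le_trans (Im_le_normc c) cr).
by apply: (le_lin2 h1 h2 ler01 ler01); rewrite /rpart; lin.
Qed.

Lemma modulus_supremums z :
  supremums [set cos t *: z.1 + sin t *: z.2 | t in [set: R]]
    (cplx_modulus z).
Proof.
rewrite /cplx_modulus /supremum; case: ifPn => [|_].
  by move=> /eqP/seteqP[/(_ (cos 0 *: z.1 + sin 0 *: z.2))]; case; exists 0.
have e0 : 0 <= vabs z.1 + vabs z.2 by apply: blat_addr_ge0; exact: vabs_ge0.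
have [b c b1 c1|m [h1 h2]] := @circle_sup (fun c => rpart c z) _ e0.
  have h := rpart_vabs z (lexx (normc (c - b))).
  apply: (le_lin1 h ler01); move: b c {b1 c1 h} => [b1 b2] [c1 c2].
  by rewrite /rpart /=; move: (Num.sqrt _) => s; lin.
case: xgetP => [//|/(_ m)[]]; split.
  move=> _ [t _ <-]; apply: (h1 (cos t +i* sin t)); apply/normc1P => /=.
  exact: cos2Dsin2.
move=> y hy; apply: h2 => c /circle_param[t [ct st]].
by apply: hy; exists t => //; rewrite ct st.
Qed.

Lemma rpart_le_modulus c z : normc c = 1 -> rpart c z <= cplx_modulus z.
Proof.
move=> /circle_param[t [ct st]]; have [h _] := modulus_supremums z.
by apply: h; exists t => //; rewrite ct st.
Qed.

Lemma modulus_le z y :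
  (forall c, normc c = 1 -> rpart c z <= y) -> cplx_modulus z <= y.
Proof.
move=> hy; have [_ h] := modulus_supremums z; apply: h => _ [t _ <-].
apply: (hy (cos t +i* sin t)); apply/normc1P => /=; exact: cos2Dsin2.
Qed.

Lemma modulus_ge0 z : 0 <= cplx_modulus z.
Proof.
have h1 := rpart_le_modulus z (normc1 R).
have h2 : rpart (- 1) z <= cplx_modulus z.
  by apply: rpart_le_modulus; rewrite normcN normc1.
have h : 0 <= 2^-1 :> R by rewrite invr_ge0.
by apply: (le_lin2 h1 h2 h h); rewrite /rpart /=; lin_setup R E; field.
Qed.

Lemma normc_real a : normc a%:C = `|a|.
Proof. by rewrite /= expr0n addr0 sqrtr_sqr. Qed.

Lemma rpart_le c z r : normc c <= r -> rpart c z <= r *: cplx_modulus z.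
Proof.
move=> cr.
apply: (@le_trans _ _ (normc c *: cplx_modulus z)); last first.
  by apply: (@le_lin1 _ _ (r - normc c) _ _ _ _ (modulus_ge0 z));
    [rewrite subr_ge0 | lin].
have [c0|c0] := eqVneq (normc c) 0.
  by rewrite c0 (eq0_normc c0) /rpart /= !scale0r addr0.
set d := ((normc c)^-1)%:C * c.
have d1 : normc d = 1.
  by rewrite normcM normc_real ger0_norm ?invr_ge0 ?normc_ge0 // mulVf.
have -> : rpart c z = normc c *: rpart d z.
  move: c0; rewrite /d /rpart; case: (c) => c1 c2 /=; move: (Num.sqrt _) => s s0.
  by lin_setup R E; field.
exact: blat_leZ (normc_ge0 c) (rpart_le_modulus z d1).
Qed.

Lemma modulusD z w : cplx_modulus (z + w) <= cplx_modulus z + cplx_modulus w.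
Proof.
apply: modulus_le => c c1; rewrite rpartD.
by apply: blat_leD; apply: rpart_le_modulus.
Qed.

Lemma normc_conj d : normc (conjc d) = normc d.
Proof. by case: d => d1 d2 /=; rewrite sqrrN. Qed.

Lemma modulusZ_le d z r : normc d <= r ->
  cplx_modulus (d *: z) <= r *: cplx_modulus z.
Proof.
move=> dr; apply: modulus_le => c c1; rewrite rpartZ; apply: rpart_le.
by rewrite normcM normc_conj c1 mulr1.
Qed.

Lemma modulusZ d z : cplx_modulus (d *: z) = normc d *: cplx_modulus z.
Proof.
apply/eqP; rewrite eq_le modulusZ_le //=.
have [d0|d0] := eqVneq (normc d) 0; first by rewrite d0 scale0r modulus_ge0.
have := @modulusZ_le d^-1 (d *: z) _ (lexx _).
rewrite normcV scalerA mulVf ?scale1r; last first.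
  by apply: contra_neq d0 => ->; exact: normc0.
by move=> /(blat_leZ (normc_ge0 d)); rewrite scalerA divff // scale1r.
Qed.

Lemma modulus_unimodular d z : normc d = 1 ->
  cplx_modulus (d *: z) = cplx_modulus z.
Proof. by rewrite modulusZ => ->; rewrite scale1r. Qed.

Lemma modulusN z : cplx_modulus (- z) = cplx_modulus z.
Proof. by rewrite -scaleN1r modulus_unimodular // normcN normc1. Qed.

Lemma vabs_Re z : vabs z.1 <= cplx_modulus z.
Proof.
rewrite vabs_le; apply/andP; split.
  have := rpart_le_modulus z (normc1 R); by rewrite /rpart /= scale1r scale0r addr0.
have : rpart (- 1) z <= cplx_modulus z.
  by apply: rpart_le_modulus; rewrite normcN normc1.
by rewrite /rpart /= scaleN1r oppr0 scale0r addr0.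
Qed.

Lemma vabs_Im z : vabs z.2 <= cplx_modulus z.
Proof.
have h (s : R) : s ^+ 2 = 1 -> s *: z.2 <= cplx_modulus z.
  move=> s1; have := @rpart_le_modulus (0 +i* s) z.
  by rewrite /rpart /= scale0r add0r; apply; rewrite expr0n add0r s1 sqrtr1.
rewrite vabs_le; apply/andP; split.
  by have := h 1; rewrite scale1r; apply; rewrite expr1n.
by have := h (-1); rewrite scaleN1r; apply; rewrite sqrrN expr1n.
Qed.

Lemma modulus_le_vabs z : cplx_modulus z <= vabs z.1 + vabs z.2.
Proof.
apply: modulus_le => c c1.
by have := @rpart_vabs c z 1; rewrite c1 scale1r; apply.
Qed.

Lemma modulus_real x : cplx_modulus ((x, 0) : EC) = vabs x.
Proof.
apply/eqP; rewrite eq_le; apply/andP; split; last exact: (vabs_Re (x, 0)).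
apply: (le_trans (modulus_le_vabs _)) => /=.
by rewrite (@vabs_ge0_id _ _ 0) // addr0.
Qed.

(** Replaces pointwise reasoning in a representation space: an affine function
    that is nonnegative on the circle stays nonnegative when the variable is
    replaced by [z / |z|].  Indeed, testing at [- b / |b|] gives [|b| <= a]. *)
Lemma affine_ge0 a b z :
  (forall h, normc h = 1 -> 0 <= a + complex.Re (conjc b * h)) ->
  0 <= a *: cplx_modulus z + rpart b z.
Proof.
move=> hab.
suff ba : normc b <= a.
  have h : rpart (- b) z <= a *: cplx_modulus z by rewrite rpart_le // normcN.
  by apply: (le_lin1 h ler01); case: (b) => b1 b2; rewrite /rpart /=; lin.
have [b0|b0] := eqVneq (normc b) 0.
  by have := hab 1 (normc1 R); rewrite b0 (eq0_normc b0) mulr1 /= addr0.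
have := hab (((- (normc b)^-1))%:C * b) _.
rewrite normcM normc_real normrN ger0_norm ?invr_ge0 ?normc_ge0 // mulVf //.
move=> /(_ erefl).
have -> : complex.Re (conjc b * ((- (normc b)^-1)%:C * b)) =
    - (normc b)^-1 * normc b ^+ 2.
  by rewrite normc_sqr; move: (normc b)^-1; case: (b) => b1 b2 i /=; ring.
by rewrite mulNr expr2 mulKf // subr_ge0.
Qed.

End Modulus.

(** * Powers of a complex vector along the circle *)

Section UnimodularPowers.
Variable R : realType.
Implicit Types (b c d : R[i]) (r t : R).

Lemma normr_normc c : `|c| = (normc c)%:C.
Proof. by case: c => a b; rewrite normc_def. Qed.

Lemma normc_unit c : normc c = 1 -> `|c| = 1.
Proof. by rewrite normr_normc => ->. Qed.

Lemma pow_lipschitz_nat b c (n : nat) : normc b = 1 -> normc c = 1 ->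
  normc (c ^+ n - b ^+ n) <= n%:R * normc (c - b).
Proof.
move=> b1 c1; rewrite subrXX normcM mulrC ler_wpM2r ?normc_ge0 //.
rewrite -lecR -normr_normc (le_trans (ler_norm_sum _ _ _)) //.
rewrite (eq_bigr (fun=> 1)) => [|i _].
  by rewrite sumr_const card_ord rmorph_nat.
by rewrite normrM !normrX !normc_unit // !expr1n mulr1.
Qed.

Lemma normcX_int c (k : int) : normc c = 1 -> normc (c ^ k) = 1.
Proof.
move=> c1; have : `|c ^ k| = 1.
  case: k => n; first by rewrite -exprnP normrX normc_unit // expr1n.
  by rewrite NegzE -exprnN normfV normrX normc_unit // expr1n invr1.
by rewrite normr_normc => -[].
Qed.

Lemma pow_lipschitz b c (k : int) : normc b = 1 -> normc c = 1 ->
  normc (c ^ k - b ^ k) <= (absz k)%:R * normc (c - b).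
Proof.
move=> b1 c1; case: k => n; first exact: pow_lipschitz_nat.
have u0 d : normc d = 1 -> d != 0.
  move=> d1; apply/eqP => d0; move: d1; rewrite d0 normc0 => /eqP.
  by rewrite eq_sym oner_eq0.
rewrite NegzE /= -!exprnN -!exprVn.
have -> : normc (c - b) = normc (c^-1 - b^-1).
  have -> : c^-1 - b^-1 = (b - c) / (c * b).
    by field; rewrite (u0 _ b1) (u0 _ c1).
  by rewrite normcM normcV normcM b1 c1 mulr1 invr1 mulr1 -normcN opprB.
by apply: pow_lipschitz_nat; rewrite normcV ?b1 ?c1 invr1.
Qed.

(** Linearizes the chord: [|c - b| ^ 2 = 2 (1 - Re (conj c b))], and
    [N <= t / 2 + N ^ 2 / (2 t)] by the arithmetic-geometric mean inequality. *)
Lemma chord_le b c t : normc b = 1 -> normc c = 1 -> 0 < t ->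
  normc (c - b) <= t / 2 + t^-1 * (1 - complex.Re (conjc c * b)).
Proof.
move=> b1 c1 t0; set N := normc (c - b).
have -> : 1 - complex.Re (conjc c * b) = N ^+ 2 / 2.
  rewrite normc_sqr; move/normc1P: b1; move/normc1P: c1.
  case: (b) (c) => [b1 b2] [c1 c2] /= hc hb; lra.
rewrite -subr_ge0.
have -> : t / 2 + t^-1 * (N ^+ 2 / 2) - N = t^-1 / 2 * (N - t) ^+ 2.
  by field; rewrite gt_eqF.
by rewrite mulr_ge0 ?sqr_ge0 // divr_ge0 // invr_ge0 ltW.
Qed.

End UnimodularPowers.

Section Calculus.
Variables (R : realType) (E : banachLatticeType R).
Local Notation EC := (complexification E).
Implicit Types (x y : E) (z w v : EC) (r s t K : R) (b c : R[i]).
Local Ltac lin := lin_setup R E; ring.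

(** The lattice version of the bound in [chord_le]: it plays the part of
    [|z - c |z||] while depending linearly on [|z|] and [z], hence it commutes
    with positive operators up to the defects of [|z|] and [z]. *)
Definition gap t c z : E :=
  (t / 2 + t^-1) *: cplx_modulus z - t^-1 *: rpart c z.

(** The supremum over [c] of [rpart c z] is [|z|], so that the infimum of the gaps
    is [(t / 2) |z|].  This replaces choosing, at each point of a representation
    space, the best [c]. *)
Lemma sup_gap t K y y0 z : 0 < t -> 0 <= K ->
  (forall c, normc c = 1 -> y <= y0 + K *: gap t c z) ->
  y <= y0 + (K * t / 2) *: cplx_modulus z.
Proof.
move=> t0 K0 h; set u := cplx_modulus z.
have Kt : 0 <= K * t^-1 by rewrite mulr_ge0 // invr_ge0 ltW.
have : cplx_modulus ((K * t^-1)%:C *: z) <= y0 + (K * (t / 2 + t^-1)) *: u - y.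
  apply: modulus_le => c c1; apply: (le_lin1 (h c c1) ler01).
  by rewrite /gap /rpart -/u; case: (c) => c1' c2 /=; lin.
rewrite modulusZ normc_real ger0_norm // -/u => h'.
by apply: (le_lin1 h' ler01); lin.
Qed.

(** The vector [x] plays the part of [|z| phi (z / |z|)].  It is the supremum over
    [c] of the lower bounds [phi c |z| - K gap c]; each upper bound
    [phi c |z| + K gap c] dominates all of them by [affine_ge0], since it does so
    on the circle. *)
Lemma lipschitz_calculus (phi : R[i] -> R) K t z : 0 <= K -> 0 < t ->
  (forall b c, normc b = 1 -> normc c = 1 ->
     phi c - phi b <= K * normc (c - b)) ->
  exists x, forall c, normc c = 1 ->
    vabs (x - phi c *: cplx_modulus z) <= K *: gap t c z.
Proof.
move=> K0 t0 hphi; set u := cplx_modulus z.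
have u0 : 0 <= u := modulus_ge0 z.
have t1 : 0 <= t^-1 by rewrite invr_ge0 ltW.
pose F c := phi c *: u - K *: gap t c z.
have Kt : 0 <= K * t^-1 by rewrite mulr_ge0.
have [||x [xub xlb]] := @circle_sup _ _ F ((K + K * t^-1) *: u).
- by apply: blat_scale_ge0; rewrite ?addr_ge0.
- move=> b c b1 c1; have h1 := rpart_le z (lexx (normc (c - b))).
  have h2 : 0 <= K * normc (c - b) - (phi c - phi b).
    by rewrite subr_ge0 hphi.
  apply: (le_lin2 h1 u0 Kt h2); rewrite /F /gap /rpart -/u.
  by move: (normc (c - b)) => N; case: (b) (c) => [? ?] [? ?] /=; lin.
exists x => c c1; rewrite vabs_le; apply/andP; split; last first.
  by apply: (le_lin1 (xub c c1) ler01); rewrite /F; lin.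
suff : x <= phi c *: u + K *: gap t c z.
  by move=> h; apply: (le_lin1 h ler01); lin.
apply: xlb => b b1.
suff h : 0 <= (phi c - phi b + 2 * (K * (t / 2 + t^-1))) *: u +
    rpart ((- (K * t^-1))%:C * (b + c)) z.
  apply: (le_lin1 h ler01); rewrite /F /gap -/u /rpart.
  by case: (b) (c) => [? ?] [? ?] /=; lin.
apply: affine_ge0.
move=> h h1.
have e1 := chord_le h1 b1 t0; have e2 := chord_le h1 c1 t0.
have e3 : normc (b - c) <= normc (b - h) + normc (c - h).
  have -> : b - c = (b - h) - (c - h) by ring.
  by rewrite (le_trans (le_normcD _ _)) // normcN.
have e4 := hphi _ _ c1 b1.
have e5 := ler_wpM2l K0 (le_trans e3 (lerD e1 e2)).
have -> : complex.Re (conjc ((- (K * t^-1))%:C * (b + c)) * h) =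
  - (K * t^-1) * (complex.Re (conjc b * h) + complex.Re (conjc c * h)).
  by case: (b) (c) (h) => [? ?] [? ?] [? ?] /=; ring.
move: e4 e5; move: (complex.Re _) (complex.Re _) => p q; lra.
Qed.

(** The vector [v] approximates [|z| (z / |z|) ^ k]; the factor 2 comes from
    treating the real and imaginary parts separately. *)
Lemma approx_power (k : int) t z : 0 < t ->
  exists v, forall c, normc c = 1 ->
    cplx_modulus (v - c ^ k *: ((cplx_modulus z, 0) : EC)) <=
    (2 * (absz k)%:R) *: gap t c z.
Proof.
move=> t0; have K0 : 0 <= (absz k)%:R :> R by rewrite ler0n.
have [b c b1 c1|x hx] := lipschitz_calculus
    (phi := fun c => complex.Re (c ^ k)) z K0 t0.
  have := le_trans (Re_le_normc _) (pow_lipschitz k b1 c1).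
  move/(le_trans (ler_norm _)); apply: le_trans.
  by case: (c ^ k) (b ^ k) => [? ?] [? ?].
have [b c b1 c1|y hy] := lipschitz_calculus
    (phi := fun c => complex.Im (c ^ k)) z K0 t0.
  have := le_trans (Im_le_normc _) (pow_lipschitz k b1 c1).
  move/(le_trans (ler_norm _)); apply: le_trans.
  by case: (c ^ k) (b ^ k) => [? ?] [? ?].
exists (x, y) => c c1; apply: (le_trans (modulus_le_vabs _)).
have -> : (2 * (absz k)%:R) *: gap t c z =
  (absz k)%:R *: gap t c z + (absz k)%:R *: gap t c z by lin.
apply: blat_leD; [move: (hx c c1)|move: (hy c c1)]; rewrite /= !scaler0.
  by rewrite subr0.
by rewrite add0r.
Qed.

Lemma modulus_pure x c : 0 <= x -> normc c = 1 ->
  cplx_modulus (c *: ((x, 0) : EC)) = x.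
Proof.
by move=> x0 c1; rewrite modulus_unimodular // modulus_real vabs_ge0_id.
Qed.

Lemma approx_power_modulus (k : int) t z v : 0 < t ->
  (forall c, normc c = 1 ->
    cplx_modulus (v - c ^ k *: ((cplx_modulus z, 0) : EC)) <=
    (2 * (absz k)%:R) *: gap t c z) ->
  cplx_modulus v <= (1 + (absz k)%:R * t) *: cplx_modulus z /\
  cplx_modulus z <= cplx_modulus v + ((absz k)%:R * t) *: cplx_modulus z.
Proof.
move=> t0 hv; set u := cplx_modulus z; set K : R := (absz k)%:R.
have K0 : 0 <= 2 * K by rewrite mulr_ge0 ?ler0n.
have pure c : normc c = 1 -> cplx_modulus (c ^ k *: ((u, 0) : EC)) = u.
  by move=> c1; rewrite modulus_pure ?modulus_ge0 ?normcX_int.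
have h1 : cplx_modulus v <= u + (2 * K * t / 2) *: u.
  apply: sup_gap => // c c1; rewrite -{1}(subrK (c ^ k *: ((u, 0) : EC)) v).
  apply: (le_trans (modulusD _ _)); rewrite pure // addrC.
  by apply: blat_leD (hv c c1).
have h2 : u <= cplx_modulus v + (2 * K * t / 2) *: u.
  apply: sup_gap => // c c1; rewrite -{1}(pure c c1).
  have -> : c ^ k *: ((u, 0) : EC) = v - (v - c ^ k *: ((u, 0) : EC)).
    by rewrite opprB addrC subrK.
  apply: (le_trans (modulusD _ _)); rewrite modulusN.
  by apply: blat_leD (hv c c1).
by split; [apply: (le_lin1 h1 ler01) | apply: (le_lin1 h2 ler01)];
  lin_setup R E; field.
Qed.

End Calculus.

(** * Norms and operators on the complexification *)

Section ComplexNorm.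
Variables (R : realType) (E : banachLatticeType R).
Local Notation EC := (complexification E).
Implicit Types (x y : E) (z w : EC) (a : R) (d : R[i]).

Lemma cplx_norm_ge0 z : 0 <= cplx_norm z. Proof. exact: normr_ge0. Qed.

Lemma cplx_norm_le z y : cplx_modulus z <= y -> cplx_norm z <= `|y|.
Proof. exact/blat_norm_ge0_le/modulus_ge0. Qed.

Lemma cplx_normD z w : cplx_norm (z + w) <= cplx_norm z + cplx_norm w.
Proof. exact: le_trans (cplx_norm_le (modulusD z w)) (ler_normD _ _). Qed.

Lemma cplx_normN z : cplx_norm (- z) = cplx_norm z.
Proof. by rewrite /cplx_norm modulusN. Qed.

Lemma cplx_normB z w : cplx_norm (z - w) <= cplx_norm z + cplx_norm w.
Proof. by rewrite -(cplx_normN w) cplx_normD. Qed.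

Lemma cplx_normZ d z : cplx_norm (d *: z) = normc d * cplx_norm z.
Proof. by rewrite /cplx_norm modulusZ normrZ ger0_norm ?normc_ge0. Qed.

Lemma norm_Re_le z : `|z.1| <= cplx_norm z.
Proof. by rewrite -vabs_norm blat_norm_ge0_le ?vabs_ge0 ?vabs_Re. Qed.

Lemma norm_Im_le z : `|z.2| <= cplx_norm z.
Proof. by rewrite -vabs_norm blat_norm_ge0_le ?vabs_ge0 ?vabs_Im. Qed.

Lemma cplx_norm_le_add z : cplx_norm z <= `|z.1| + `|z.2|.
Proof.
apply: (le_trans (cplx_norm_le (modulus_le_vabs z))).
by rewrite (le_trans (ler_normD _ _)) // !vabs_norm.
Qed.

Lemma cplx_norm0_eq0 z : cplx_norm z = 0 -> z = 0.
Proof.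
move=> z0; have := norm_Re_le z; have := norm_Im_le z; rewrite z0.
by case: z {z0} => x y /=; rewrite !normr_le0 => /eqP -> /eqP ->.
Qed.

Lemma cplx_norm0 : cplx_norm (0 : EC) = 0.
Proof. by rewrite -(scale0r (0 : EC)) cplx_normZ normc0 mul0r. Qed.

Lemma cplx_norm_real x : cplx_norm ((x, 0) : EC) = `|x|.
Proof. by rewrite /cplx_norm modulus_real vabs_norm. Qed.

Lemma op_norm_boundP (f : EC -> EC) (M : R) :
  (forall d z, f (d *: z) = d *: f z) -> 0 <= M ->
  (op_norm f <= M%:E)%E -> forall z, cplx_norm (f z) <= M * cplx_norm z.
Proof.
move=> fZ M0 fM z; have [z0|z0] := eqVneq (cplx_norm z) 0.
  have -> : z = 0 by exact: cplx_norm0_eq0.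
  by rewrite -(scale0r (0 : EC)) fZ !cplx_normZ !normc0 !mul0r mulr0.
have zp : 0 < cplx_norm z by rewrite lt_def z0 cplx_norm_ge0.
set d := ((cplx_norm z)^-1)%:C.
have dn : normc d = (cplx_norm z)^-1.
  by rewrite normc_real gtr0_norm // invr_gt0.
have : ((cplx_norm (f (d *: z)))%:E <= M%:E)%E.
  apply: le_trans fM; apply: ereal_sup_ubound; exists (d *: z) => //=.
  by rewrite cplx_normZ dn mulVf.
by rewrite lee_fin fZ cplx_normZ dn mulrC ler_pdivrMr.
Qed.

Lemma op_norm_lty_bound (f : EC -> EC) :
  (forall d z, f (d *: z) = d *: f z) -> (op_norm f < +oo)%E ->
  exists2 K : R, 0 <= K & forall z, cplx_norm (f z) <= K * cplx_norm z.
Proof.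
move=> fZ; case e : (op_norm f) => [r| |] // _.
- exists (Num.max r 0); first by rewrite le_max lexx orbT.
  apply: op_norm_boundP => //; first by rewrite le_max lexx orbT.
  by rewrite e lee_fin le_max lexx.
- exists 0 => //; apply: op_norm_boundP => //.
  by rewrite e leNye.
Qed.

Lemma op_norm_lty (f : EC -> EC) (K : R) : 0 <= K ->
  (forall z, cplx_norm (f z) <= K * cplx_norm z) -> (op_norm f < +oo)%E.
Proof.
move=> K0 fK; apply: (@le_lt_trans _ _ K%:E); last exact: ltry.
apply: ge_ereal_sup => _ [z /= z1 <-]; rewrite lee_fin.
by apply: (le_trans (fK z)); rewrite -[leRHS]mulr1 ler_wpM2l.
Qed.

Lemma iter_scalable (T : {linear EC -> EC}) n d z :
  iter n T (d *: z) = d *: iter n T z.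
Proof. by elim: n => //= n ->; rewrite linearZ. Qed.

Lemma power_bound (T : {linear EC -> EC}) : power_bounded T ->
  exists2 M : R, 1 <= M &
    forall n z, cplx_norm (iter n T z) <= M * cplx_norm z.
Proof.
rewrite /power_bounded; set s := ereal_sup _ => slty.
have hs n : (op_norm (iter n T) <= s)%E by apply: ereal_sup_ubound; exists n.
pose M := Num.max (fine s) 1.
have M1 : 1 <= M by rewrite le_max lexx orbT.
have sM : (s <= M%:E)%E.
  case e : s slty => [r| |] // _; last by rewrite leNye.
  by rewrite /M e lee_fin le_max lexx.
exists M => // n; apply: op_norm_boundP; first exact: iter_scalable.
  exact: le_trans M1.
exact: le_trans (hs n) sM.
Qed.

End ComplexNorm.

Section RealRestriction.
Variables (R : realType) (E : banachLatticeType R).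
Local Notation EC := (complexification E).
Variable T : {linear EC -> EC}.
Implicit Types (x y : E) (z w : EC) (a : R) (c : R[i]).

Definition real_op x : E := (T ((x, 0) : EC)).1.

Fact real_op_linear : linear real_op.
Proof.
move=> a x y; rewrite /real_op.
have -> : ((a *: x + y, 0) : EC) = a%:C *: ((x, 0) : EC) + ((y, 0) : EC).
  by congr (_, _); rewrite /= !scale0r ?scaler0 ?subr0 ?addr0.
by rewrite linearP /= scale0r subr0.
Qed.

HB.instance Definition _ := GRing.isLinear.Build R E E *:%R real_op
  real_op_linear.

Hypothesis T_pos : positive_op T.

Lemma real_op_ge0 x : 0 <= x -> 0 <= real_op x.
Proof. by move=> x0; have [] := @T_pos (x, 0). Qed.

(** A positive operator is real, because every real vector is a difference of
    positive ones. *)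
Lemma real_opE z : T z = (real_op z.1, real_op z.2).
Proof.
have im0 x : (T ((x, 0) : EC)).2 = 0.
  have -> : ((x, 0) : EC) = ((vabs x, 0) : EC) - ((vabs x - x, 0) : EC).
    by congr (_, _); rewrite /= ?subr0 // opprB addrC subrK.
  rewrite linearB /=.
  have [-> _] := T_pos (conj erefl (vabs_ge0 x) : cplx_ge0 (vabs x, 0)).
  have d0 : 0 <= vabs x - x by rewrite blat_subr_ge0 le_vabs.
  have [-> _] := T_pos (conj erefl d0 : cplx_ge0 (vabs x - x, 0)).
  by rewrite subr0.
have ez : z = ((z.1, 0) : EC) + 'i *: ((z.2, 0) : EC).
  case: z => x y; apply: injective_projections;
    by rewrite /= !scale0r ?scaler0 ?scale1r ?subr0 ?addr0 ?add0r.
rewrite {1}ez linearD linearZ /=.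
have e x : T ((x, 0) : EC) = (real_op x, 0).
  by apply: injective_projections; rewrite //= im0.
rewrite !e; apply: injective_projections;
  by rewrite /= !scale0r ?scaler0 ?scale1r ?subr0 ?addr0 ?add0r.
Qed.

End RealRestriction.

Section Complexified.
Variables (R : realType) (E : banachLatticeType R).
Local Notation EC := (complexification E).
Variables (T : {linear EC -> EC}) (P : {linear E -> E}).
Implicit Types (x y : E) (z : EC) (c : R[i]).
Hypothesis TE : forall z, T z = (P z.1, P z.2).
Hypothesis P_ge0 : forall x, 0 <= x -> 0 <= P x.

Lemma pos_op_le x y : x <= y -> P x <= P y.
Proof.
by rewrite -blat_subr_ge0 => /P_ge0; rewrite linearB blat_subr_ge0.
Qed.

Lemma op_rpart c z : P (rpart c z) = rpart c (T z).
Proof. by rewrite TE /rpart linearD !linearZ. Qed.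

Lemma modulus_op_le z : cplx_modulus (T z) <= P (cplx_modulus z).
Proof.
apply: modulus_le => c c1; rewrite -op_rpart.
exact/pos_op_le/rpart_le_modulus.
Qed.

Lemma iter_complexified n x : iter n T ((x, 0) : EC) = (iter n P x, 0).
Proof. by elim: n => //= n ->; rewrite TE /= linear0. Qed.

Lemma real_power_bound (M : R) :
  (forall n z, cplx_norm (iter n T z) <= M * cplx_norm z) ->
  forall n x, `|iter n P x| <= M * `|x|.
Proof.
by move=> h n x; have := h n (x, 0); rewrite iter_complexified !cplx_norm_real.
Qed.

End Complexified.

(** * Cesaro means of a power-bounded positive operator *)

Lemma inv_pow_small (R : realType) (e C d : R) : 0 < e -> 0 < d -> 0 <= C ->
  exists n : nat, (1 + e)^-1 ^+ n * C <= d.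
Proof.
move=> e0 d0 C0.
have q0 : 0 < 1 + e by rewrite addr_gt0.
(* Bernoulli's inequality *)
have bern m : 1 + m%:R * e <= (1 + e) ^+ m.
  elim: m => [|m IH]; first by rewrite mul0r addr0 expr0.
  rewrite exprS -natr1.
  have me : 0 <= m%:R * e by rewrite mulr_ge0 // ltW.
  have := ler_wpM2l (ltW q0) IH.
  have := mulr_ge0 me (ltW e0); lra.
have [n /(_ n (leqnn n)) hn] := div_natS_small (C / e) d0.
exists n.+1; apply: le_trans hn.
have pn : (1 + e)^-1 ^+ n.+1 <= (n.+1%:R * e)^-1.
  rewrite exprVn lef_pV2 ?posrE ?exprn_gt0 ?mulr_gt0 ?ltr0n //.
  by apply: le_trans (bern n.+1); rewrite lerDr.
have := ler_wpM2r C0 pn.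
by rewrite invfM => /le_trans; apply; rewrite le_eqVlt; apply/orP; left;
  apply/eqP; ring.
Qed.

Section Means.
Variables (R : realType) (E : banachLatticeType R).
Variables (P : {linear E -> E}) (M : R).
Implicit Types (x y a b : E) (n N m : nat) (e : R).
Hypothesis P_ge0 : forall x, 0 <= x -> 0 <= P x.
Hypothesis M_ge1 : 1 <= M.
Hypothesis P_bound : forall n x, `|iter n P x| <= M * `|x|.
Local Ltac lin := lin_setup R E; ring.

Let M_ge0 : 0 <= M. Proof. exact: le_trans M_ge1. Qed.

Lemma iter_ge0 n x : 0 <= x -> 0 <= iter n P x.
Proof. by move=> x0; elim: n => //= n; exact: P_ge0. Qed.

Lemma iterB_op n x y : iter n P (x - y) = iter n P x - iter n P y.
Proof. by elim: n => //= n ->; rewrite linearB. Qed.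

Lemma iterD_op n x y : iter n P (x + y) = iter n P x + iter n P y.
Proof. by elim: n => //= n ->; rewrite linearD. Qed.

Lemma iterZ_op n e x : iter n P (e *: x) = e *: iter n P x.
Proof. by elim: n => //= n ->; rewrite linearZ. Qed.

Definition mean N x : E := N.+1%:R^-1 *: \sum_(n < N.+1) iter n P x.

Fact mean_linear N : linear (mean N).
Proof.
move=> c x y; rewrite /mean scalerA mulrC -scalerA -scalerDr; congr (_ *: _).
rewrite scaler_sumr -big_split /=; apply: eq_bigr => n _.
by rewrite iterD_op iterZ_op.
Qed.

HB.instance Definition _ N := GRing.isLinear.Build R E E *:%R (mean N)
  (mean_linear N).

Lemma mean_ge0 N x : 0 <= x -> 0 <= mean N x.
Proof.
move=> x0; apply: blat_scale_ge0; first by rewrite invr_ge0.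
by elim/big_ind: _ => // [y z|n _]; [exact: blat_addr_ge0 | exact: iter_ge0].
Qed.

Lemma mean_le N x y : x <= y -> mean N x <= mean N y.
Proof.
by rewrite -blat_subr_ge0 => /(mean_ge0 N); rewrite linearB blat_subr_ge0.
Qed.

Lemma mean_bound N x : `|mean N x| <= M * `|x|.
Proof.
rewrite /mean normrZ ger0_norm ?invr_ge0 // mulrC ler_pdivrMr ?ltr0n //.
apply: (le_trans (ler_norm_sum _ _ _)).
apply: (le_trans (ler_sum _ (fun (n : 'I_N.+1) _ => P_bound n x))).
by rewrite sumr_const card_ord mulr_natr.
Qed.

Lemma mean_comm N x : mean N (P x) = P (mean N x).
Proof.
rewrite /mean [RHS]linearZ [in RHS]linear_sum; congr (_ *: _); apply: eq_bigr => n _.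
by rewrite -iterSr.
Qed.

(** [A (P x - x)] telescopes to [(P ^ N.+1 x - x) / N.+1]: means make every vector
    almost fixed. *)
Lemma mean_defect N x :
  `|mean N (P x - x)| <= (M + 1) * `|x| / N.+1%:R.
Proof.
have -> : mean N (P x - x) = N.+1%:R^-1 *: (iter N.+1 P x - x).
  rewrite /mean; congr (_ *: _).
  rewrite -(big_mkord xpredT (fun n => iter n P (P x - x))).
  rewrite (eq_bigr (fun n => iter n.+1 P x - iter n P x)) => [|n _].
    by rewrite telescope_sumr.
  by rewrite iterB_op -iterSr.
rewrite normrZ ger0_norm ?invr_ge0 // mulrC ler_wpM2r ?invr_ge0 //.
rewrite (le_trans (ler_normB _ _)) // mulrDl mul1r lerD2r; exact: P_bound.
Qed.

(** Iterating [x <= P x + y] gives [x <= P ^ n x + y + P y + ... + P ^ n.-1 y] for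
    each [n <= N], and the sum is at most [N.+1 A y]; then average over [n]. *)
Lemma le_mean_add N x y : 0 <= y -> x <= P x + y ->
  x <= mean N x + N.+1%:R *: mean N y.
Proof.
move=> y0 xy; rewrite /mean.
rewrite scalerA divff ?pnatr_eq0 // scale1r; set s := \sum_(n < _) iter n P y.
have h n : (n <= N)%N -> x <= iter n P x + s.
  move=> nN; apply: (@le_trans _ _ (iter n P x + \sum_(j < n) iter j P y)).
    elim: n {nN} => [|n IH]; first by rewrite big_ord0 addr0.
    rewrite big_ord_recr /=.
    have h : 0 <= iter n P (P x + y - x) by rewrite iter_ge0 ?blat_subr_ge0.
    apply: (le_lin2 IH h ler01 ler01).
    by rewrite iterB_op iterD_op -iterSr /=; lin.
  have : 0 <= \sum_(n <= j < N.+1) iter j P y.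
    by elim/big_ind: _ => // [u v|j _]; [exact: blat_addr_ge0 | exact: iter_ge0].
  move=> /le_lin1; apply; first exact: ler01.
  rewrite /s -!(big_mkord xpredT (fun j => iter j P y)).
  by rewrite (big_cat_nat (n := n) (p := N.+1)) ?leqW //=; lin.
have N0 : 0 <= N.+1%:R^-1 :> R by rewrite invr_ge0.
have : \sum_(n < N.+1) x <= \sum_(n < N.+1) (iter n P x + s).
  elim/big_rec2: _ => // n u v _; apply: blat_leD; apply: h.
  by rewrite -ltnS.
have e (y' : E) : y' *+ N.+1 = N.+1%:R *: y' by rewrite scaler_nat.
rewrite big_split /= !sumr_const card_ord !e => h'.
apply: (le_lin1 h' N0); lin_setup R E; field; by rewrite ?pnatr_eq0.
Qed.

(** The Neumann series of [((1 + e) - P)^-1], whose norm is at most [M / e], used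
    only through its partial sums: iterating [a <= p P a + p b] with
    [p = 1 / (1 + e)] bounds [a] by such a sum and a remainder [p ^ m P ^ m a]. *)
Lemma subeigen_bound e a b : 0 < e -> 0 <= a ->
  (1 + e) *: a <= P a + b -> `|a| <= M / e * `|b|.
Proof.
move=> e0 a0 hab; pose p := (1 + e)^-1.
have q0 : 0 < 1 + e by rewrite addr_gt0.
have p0 : 0 < p by rewrite invr_gt0.
have pe : p * (1 + e) = 1 by rewrite mulVf // gt_eqF.
have iterate m : exists2 s : E, a <= p ^+ m *: iter m P a + s &
    `|s| <= M / e * `|b| * (1 - p ^+ m).
  elim: m => [|m [s hs sb]].
    by exists 0; rewrite ?expr0 ?scale1r ?addr0 // subrr mulr0 normr0.
  have pm : 0 <= p ^+ m.+1 by rewrite exprn_ge0 // ltW.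
  have pmS : p ^+ m = p ^+ m.+1 * (1 + e) by rewrite exprS mulrAC pe mul1r.
  exists (s + p ^+ m.+1 *: iter m P b).
    have h : 0 <= iter m P (P a + b - (1 + e) *: a).
      by rewrite iter_ge0 ?blat_subr_ge0.
    apply: (le_lin2 hs h ler01 pm).
    rewrite iterB_op iterD_op iterZ_op -iterSr pmS.
    by rewrite /=; lin.
  rewrite (le_trans (ler_normD _ _)) //.
  have := P_bound m b; move/(ler_wpM2l pm).
  rewrite normrZ (ger0_norm pm) => h.
  apply: (le_trans (lerD sb h)).
  have -> : M / e * `|b| * (1 - p ^+ m.+1) = M / e * `|b| * (1 - p ^+ m) +
    M / e * `|b| * (p ^+ m - p ^+ m.+1) by ring.
  rewrite lerD2l.
  have -> : p ^+ m - p ^+ m.+1 = p ^+ m.+1 * e.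
    by rewrite pmS; ring.
  by rewrite le_eqVlt; apply/orP; left; apply/eqP; field; rewrite gt_eqF.
apply/ler_addgt0Pr => d d0.
have [n hn] := inv_pow_small e0 d0 (mulr_ge0 M_ge0 (normr_ge0 a)).
have [s hs sb] := iterate n.
have Mb : 0 <= M / e * `|b| by rewrite !mulr_ge0 ?invr_ge0 // ltW.
have pn : 0 <= p ^+ n by rewrite exprn_ge0 // ltW.
apply: (le_trans (blat_norm_ge0_le a0 hs)).
apply: (le_trans (ler_normD _ _)); rewrite addrC; apply: lerD.
  by apply: (le_trans sb); rewrite -[leRHS]mulr1 ler_wpM2l // gerBl.
rewrite normrZ (ger0_norm pn); apply: le_trans hn.
by rewrite -/p; apply: (ler_wpM2l pn); exact: P_bound.
Qed.

End Means.

(** * Approximate eigenvectors *)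

Section ApproximateEigenvectors.
Variables (R : realType) (E : banachLatticeType R).
Local Notation EC := (complexification E).
Variables (T : {linear EC -> EC}) (M : R).
Implicit Types (x y : E) (z w u : EC) (a e d : R) (lam : R[i]).
Hypothesis M_ge1 : 1 <= M.
Hypothesis T_bound : forall n z, cplx_norm (iter n T z) <= M * cplx_norm z.

Local Ltac clin := lin_setup (R[i]) (complexification E); ring.

Let M_ge0 : 0 <= M. Proof. exact: le_trans M_ge1. Qed.

Lemma cplx_harmonic_cauchy_lim (u : nat -> EC) (C : R) : 0 <= C ->
  (forall n p, cplx_norm (u n - u p) <= C / n.+1%:R + C / p.+1%:R) ->
  exists l, forall n, cplx_norm (u n - l) <= 2 * C / n.+1%:R.
Proof.
move=> C0 hu.
have [x hx] := harmonic_cauchy_lim C0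
  (fun n p => le_trans (norm_Re_le (u n - u p)) (hu n p)).
have [y hy] := harmonic_cauchy_lim C0
  (fun n p => le_trans (norm_Im_le (u n - u p)) (hu n p)).
exists (x, y) => n; apply: (le_trans (cplx_norm_le_add _)).
apply: (le_trans (lerD (hx n) (hy n))).
by rewrite -mulrA mulr_natl mulr2n.
Qed.

(** Solve the equation at the nearby point [mu = (1 + s) lam] outside the unit
    disc by a partial Neumann sum [u].  The lower bound for [lam - T] survives at
    [mu] with [a / 2], so [u] is bounded by [C] independently of [s], and going
    back from [mu] to [lam] costs only [s * C], besides the tail of the
    series. *)
Lemma resolvent_eq_approx_sol lam a w e : normc lam = 1 -> 0 < a -> 0 < e ->
  (forall z, a * cplx_norm z <= cplx_norm (lam *: z - T z)) ->
  exists u, cplx_norm (lam *: u - T u - w) <= e.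
Proof.
move=> lam1 a0 e0 low.
pose C := (2 / a) * ((1 + M) * cplx_norm w).
have w0 := cplx_norm_ge0 w.
have C0 : 0 <= C by rewrite !mulr_ge0 ?invr_ge0 ?addr_ge0 // ltW.
pose s := Num.min (a / 2) (e / 2 / (C + 1)).
have C1 : 0 < C + 1 by rewrite ltr_wpDl.
have s0 : 0 < s by rewrite lt_min !divr_gt0.
have sa : s <= a / 2 by rewrite ge_min lexx.
have sC : s * C <= e / 2.
  apply: (@le_trans _ _ (s * (C + 1))); first by rewrite ler_pM2l // lerDl.
  by rewrite -ler_pdivlMr // ge_min lexx orbT.
have e20 : 0 < e / 2 by rewrite divr_gt0.
have [m hm] := inv_pow_small s0 e20 (mulr_ge0 M_ge0 w0).
pose mu := (1 + s)%:C * lam.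
have s1 : 0 < 1 + s by rewrite addr_gt0.
have nmu : normc mu = 1 + s by rewrite normcM normc_real gtr0_norm // lam1 mulr1.
have mu0 : mu != 0.
  by apply: contra_eq_neq nmu => ->; rewrite normc0 eq_sym gt_eqF.
have [u hu] : exists u, mu *: u - T u = w - mu^-1 ^+ m *: iter m T w.
  elim: m {hm} => [|m [u hu]].
    by exists 0; rewrite scaler0 linear0 subrr expr0 scale1r subrr.
  exists (u + mu^-1 ^+ m.+1 *: iter m T w).
  rewrite scalerDr [T (u + _)]linearD [T (_ *: _)]linearZ /= scalerA opprD addrACA.
  rewrite hu exprS mulVKf //.
  by rewrite addrA subrK.
have nmum : normc (mu^-1 ^+ m) = (1 + s)^-1 ^+ m.
  by elim: (m) => [|k IH]; rewrite ?expr0 ?normc1 // !exprS normcM IH normcV nmu.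
have tail : cplx_norm (mu^-1 ^+ m *: iter m T w) <= e / 2.
  rewrite cplx_normZ nmum; apply: le_trans hm.
  by rewrite ler_wpM2l // exprn_ge0 // invr_ge0 ltW.
have tail' : cplx_norm (mu^-1 ^+ m *: iter m T w) <= M * cplx_norm w.
  rewrite cplx_normZ nmum -[leRHS]mul1r.
  apply: ler_pM (T_bound m w); rewrite ?cplx_norm_ge0 //.
    by rewrite exprn_ge0 // invr_ge0 ltW.
  by rewrite exprn_ile1 // ?invr_ge0 ?(ltW s1) // invf_le1 // lerDl ltW.
have diff : lam *: u - T u = mu *: u - T u - s%:C *: (lam *: u).
  by rewrite /mu rmorphD rmorph1; clin.
have su : cplx_norm (s%:C *: (lam *: u)) = s * cplx_norm u.
  by rewrite !cplx_normZ lam1 mul1r normc_real gtr0_norm.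
have uC : cplx_norm u <= C.
  have h1 := low u; have h2 := cplx_normB (mu *: u - T u) (s%:C *: (lam *: u)).
  rewrite -diff su hu in h2.
  have h3 := cplx_normB w (mu^-1 ^+ m *: iter m T w).
  have h4 := ler_wpM2r (cplx_norm_ge0 u) sa.
  rewrite /C mulrAC ler_pdivlMr //; lra.
exists u; rewrite diff hu.
have -> : w - mu^-1 ^+ m *: iter m T w - s%:C *: (lam *: u) - w =
    - (mu^-1 ^+ m *: iter m T w + s%:C *: (lam *: u)).
  by clin.
rewrite cplx_normN (le_trans (cplx_normD _ _)) // su.
have := ler_wpM2l (ltW s0) uC; lra.
Qed.

(** The lower bound makes approximate solutions Cauchy. *)
Lemma resolvent_eq_sol lam a w : normc lam = 1 -> 0 < a ->
  (forall z, a * cplx_norm z <= cplx_norm (lam *: z - T z)) ->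
  exists u, lam *: u - T u = w.
Proof.
move=> lam1 a0 low.
have D_B z z' : lam *: (z - z') - T (z - z') =
    (lam *: z - T z) - (lam *: z' - T z').
  by rewrite [T (_ - _)]linearB /=; clin.
have a1 n : 0 < a / n.+1%:R by rewrite divr_gt0.
have /choice[u hu] n := resolvent_eq_approx_sol w lam1 a0 (a1 n) low.
have [|l hl] := @cplx_harmonic_cauchy_lim u 1 ler01.
  move=> n p; rewrite -(ler_pM2l a0); apply: (le_trans (low _)).
  rewrite D_B; set U := lam *: u n - _; set V := lam *: u p - _.
  have -> : U - V = (U - w) - (V - w) by clin.
  apply: (le_trans (cplx_normB _ _)).
  by rewrite mulrDr !mul1r; apply: lerD; exact: hu.
exists l; apply/eqP; rewrite -subr_eq0; apply/eqP/cplx_norm0_eq0/eqP.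
rewrite eq_le cplx_norm_ge0 andbT; apply/ler_addgt0Pr => e e0; rewrite add0r.
have [n /(_ n (leqnn n)) hn] := div_natS_small ((1 + M) * 2 + a) e0.
apply: le_trans hn.
set U := lam *: l - T l; set V := lam *: u n - T (u n).
have -> : U - w = (V - w) - (V - U) by clin.
apply: (le_trans (cplx_normB _ _)).
rewrite [leRHS]mulrDl addrC; apply: lerD; last exact: hu.
rewrite -D_B; apply: (le_trans (cplx_normB _ _)).
rewrite cplx_normZ lam1 mul1r -mulrA mulrDl mul1r.
have h := hl n; rewrite mulr1 in h; apply: lerD => //.
by apply: (le_trans (T_bound 1 _)); rewrite ler_wpM2l.
Qed.

Lemma bounded_below_resolvent lam a : normc lam = 1 -> 0 < a ->
  (forall z, a * cplx_norm z <= cplx_norm (lam *: z - T z)) ->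
  resolvent_set T lam.
Proof.
move=> lam1 a0 low.
have /choice[S hS] w := resolvent_eq_sol w lam1 a0 low.
have inj z z' : lam *: z - T z = lam *: z' - T z' -> z = z'.
  move=> zz; apply/eqP; rewrite -subr_eq0; apply/eqP/cplx_norm0_eq0/eqP.
  have := low (z - z').
  have -> : lam *: (z - z') - T (z - z') =
      (lam *: z - T z) - (lam *: z' - T z').
    by rewrite [T (_ - _)]linearB /=; clin.
  rewrite zz subrr.
  rewrite cplx_norm0 pmulr_rle0 // => h; rewrite eq_le h.
  exact: cplx_norm_ge0.
have Slin : linear S.
  move=> b z z'; apply: inj; rewrite hS [T (_ + _)]linearD /=.
  by rewrite -{1}(hS z) -{1}(hS z') linearZ /=; clin.
exists (HB.pack_for {linear EC -> EC} S (GRing.isLinear.Build _ _ _ _ S Slin)).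
split => //=; last by move=> z; apply: inj; rewrite hS.
apply: (@op_norm_lty _ _ _ a^-1) => [|z]; first by rewrite invr_ge0 ltW.
by rewrite mulrC ler_pdivlMr // mulrC -{2}(hS z) low.
Qed.

Lemma approx_eigenvector lam d : normc lam = 1 -> spectrum T lam -> 0 < d ->
  exists2 z, cplx_norm z = 1 & cplx_norm (lam *: z - T z) <= d.
Proof.
move=> lam1 sp d0; apply: contrapT => none; apply: sp.
apply: (bounded_below_resolvent lam1 d0) => z.
rewrite leNgt; apply/negP => lt; apply: none.
have z0 : 0 < cplx_norm z.
  rewrite lt_def cplx_norm_ge0 andbT; apply: contraTneq lt => z0.
  by rewrite z0 mulr0 -leNgt cplx_norm_ge0.
set c := (cplx_norm z)^-1%:C.
have nc : normc c = (cplx_norm z)^-1.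
  by rewrite normc_real gtr0_norm // invr_gt0.
exists (c *: z); first by rewrite cplx_normZ nc mulVf // gt_eqF.
have -> : lam *: (c *: z) - T (c *: z) = c *: (lam *: z - T z).
  by rewrite [T (_ *: _)]linearZ /=; clin.
by rewrite cplx_normZ nc mulrC ler_pdivrMr // ltW.
Qed.

End ApproximateEigenvectors.

(** * Cyclicity *)

Section Cyclicity.
Variables (R : realType) (E : banachLatticeType R).
Local Notation EC := (complexification E).
Variables (T : {linear EC -> EC}) (P : {linear E -> E}) (M : R).
Implicit Types (x y : E) (z w v : EC) (t e : R) (lam : R[i]) (k : int).
Hypothesis TE : forall z, T z = (P z.1, P z.2).
Hypothesis P_ge0 : forall x, 0 <= x -> 0 <= P x.
Hypothesis M_ge1 : 1 <= M.
Hypothesis T_bound : forall n z, cplx_norm (iter n T z) <= M * cplx_norm z.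
Local Notation A := (mean P).
Local Notation "`| z |m" := (cplx_modulus z) (format "`| z |m").
Local Ltac lin := lin_setup R E; ring.
Local Ltac clin := lin_setup (R[i]) (complexification E); ring.

Let M_gt0 : 0 < M. Proof. exact: lt_le_trans M_ge1. Qed.
Let M_ge0 : 0 <= M. Proof. exact: ltW. Qed.
Let P_bound := real_power_bound TE T_bound.
Let T_le := modulus_op_le TE P_ge0.

Lemma mean_norm_le N x y : 0 <= x -> x <= y -> `|A N x| <= `|A N y|.
Proof. by move=> x0 xy; apply: blat_norm_ge0_le; [exact: mean_ge0|exact: mean_le]. Qed.

Lemma mean_norm_addZ N a x y : 0 <= a ->
  `|A N (x + a *: y)| <= `|A N x| + a * `|A N y|.
Proof.
move=> a0; have e : `|a *: A N y| = a * `|A N y| by rewrite normrZ ger0_norm.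
by rewrite linearD linearZ /= -e ler_normD.
Qed.

(** From [|z| <= P |z| + q] with [q = |lam z - T z|] small, the defect
    [P |z| - |z|] is at least [- q], so its absolute value is at most
    [(P |z| - |z|) + 2 q], whose mean is small.  The number [N] is fixed first, to
    make [A (P |z| - |z|)] small; the eigenvector is then taken so good that the
    mean over [N.+1] steps still dominates most of [|z|]. *)
Lemma almost_fixed_modulus lam e : normc lam = 1 -> spectrum T lam -> 0 < e ->
  exists N z, [/\ cplx_norm z = 1, 3 / 4 <= `|A N `|z|m|,
    `|A N `|lam *: z - T z|m| <= e &
    `|A N (vabs (P `|z|m - `|z|m))| <= e].
Proof.
move=> lam1 sp e0.
have e20 : 0 < e / 2 by rewrite divr_gt0.
have [N /(_ N (leqnn N)) hN] := div_natS_small (M + 1) e20.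
have N0 : 0 < N.+1%:R :> R by rewrite ltr0n.
(* The two bounds control [M * d] for the defects, and [N.+1 * M * d] for what the
   mean loses of [|z|]. *)
pose d := Num.min (e / (4 * M)) ((4 * (N.+1%:R * M))^-1).
have d0 : 0 < d by rewrite lt_min divr_gt0 ?invr_gt0 ?mulr_gt0.
have [z z1 hz] := approx_eigenvector M_ge1 T_bound lam1 sp d0.
set u := `|z|m; set q := `|lam *: z - T z|m.
have u0 : 0 <= u := modulus_ge0 _; have q0 : 0 <= q := modulus_ge0 _.
have un : `|u| = 1 by [].
have qn : `|A N q| <= M * d.
  by apply: (le_trans (mean_bound P_bound N q)); rewrite ler_wpM2l.
have de : M * d <= e / 4.
  have : d <= e / (4 * M) by rewrite ge_min lexx.
  move/(ler_wpM2l M_ge0)/le_trans; apply; rewrite le_eqVlt; apply/orP; left.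
  by apply/eqP; field; rewrite gt_eqF.
have dN : N.+1%:R * (M * d) <= 1 / 4.
  have : d <= (4 * (N.+1%:R * M))^-1 by rewrite ge_min lexx orbT.
  have NM : 0 <= N.+1%:R * M by rewrite mulr_ge0.
  rewrite [N.+1%:R * (M * d)]mulrA => /(ler_wpM2l NM)/le_trans; apply.
  rewrite le_eqVlt; apply/orP; left.
  apply/eqP; rewrite invfM mulrCA divff ?mulr1 ?div1r // gt_eqF // mulr_gt0 //.
have uPq : u <= P u + q.
  rewrite /u -(modulus_unimodular z lam1) -{1}(subrK (T z) (lam *: z)).
  apply: (le_trans (modulusD _ _)); rewrite -/q modulus_unimodular //.
  by rewrite [X in _ <= X]addrC; apply: blat_leD => //; exact: T_le.
exists N, z; split => //.
- have h := le_mean_add P_ge0 N q0 uPq.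
  have := blat_norm_ge0_le u0 h; rewrite un => h1.
  have h2 : `|A N u + N.+1%:R *: A N q| <= `|A N u| + N.+1%:R * `|A N q|.
    have e' : `|N.+1%:R *: A N q| = N.+1%:R * `|A N q|.
      by rewrite normrZ ger0_norm.
    by rewrite -e' ler_normD.
  move: (le_trans (ler_wpM2l (ltW N0) qn) dN) (le_trans h1 h2); rewrite -/u.
  by move: (N.+1%:R * `|A N q|) => s; lra.
- by rewrite -/q; lra.
have he : vabs (P u - u) <= P u - u + 2 *: q.
  have two : 0 <= 2 :> R by [].
  rewrite vabs_le; apply/andP; split.
    by apply: (le_lin1 q0 two); lin.
  by apply: (le_lin1 uPq two); lin.
apply: (le_trans (mean_norm_le N (vabs_ge0 _) he)).
have h1 := mean_defect P_bound N u; rewrite un mulr1 in h1.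
apply: (le_trans (@mean_norm_addZ N 2 (P u - u) q (ler0n _ 2))).
apply: (le_trans (lerD (le_trans h1 hN) (ler_wpM2l (ler0n _ 2) (le_trans qn de)))).
lra.
Qed.

(** With [b = lam c], the vector [lam ^ k v - T v] splits into
    [lam ^ k (v - c ^ k u)], [b ^ k (u - P u)] and [T (v - b ^ k u)], where
    [u = |z|].  The outer terms are controlled by the gaps at [c] and [b], and [P]
    maps the gap at [b] to the gap at [c] up to defects, because
    [rpart b (lam z) = rpart c z]. *)
Lemma defect_le lam k t z v c : normc lam = 1 -> 0 < t -> normc c = 1 ->
  (forall b, normc b = 1 ->
    `|v - b ^ k *: ((`|z|m, 0) : EC)|m <= (2 * (absz k)%:R) *: gap t b z) ->
  `|lam ^ k *: v - T v|m <=
    vabs (P `|z|m - `|z|m) + (2 * (absz k)%:R) *: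
      ((t / 2 + t^-1) *: vabs (P `|z|m - `|z|m) + t^-1 *: `|lam *: z - T z|m) +
    (2 * (2 * (absz k)%:R)) *: gap t c z.
Proof.
move=> lam1 t0 c1 hv.
set u := `|z|m in hv *; set q := `|lam *: z - T z|m; set d := vabs _.
set K : R := 2 * (absz k)%:R in hv *.
have K0 : 0 <= K by rewrite mulr_ge0 ?ler0n.
have u0 : 0 <= u := modulus_ge0 _.
have b1 : normc (lam * c) = 1 by rewrite normcM lam1 c1 mulr1.
set b := lam * c in b1.
set U : EC := (u, 0).
have e1 : lam ^ k *: v - T v = lam ^ k *: (v - c ^ k *: U) +
    b ^ k *: ((u - P u, 0) : EC) - T (v - b ^ k *: U).
  have -> : ((u - P u, 0) : EC) = U - T U.
    by rewrite (TE U) linear0; congr (_, _); rewrite subr0.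
  rewrite [T (v - _)]linearB [T (_ *: _)]linearZ /= /b exprzMl ?unitfE; last 2 first.
  - by apply: contra_eq_neq lam1 => ->; rewrite normc0 eq_sym oner_eq0.
  - by apply: contra_eq_neq c1 => ->; rewrite normc0 eq_sym oner_eq0.
  by move: (lam ^ k) (c ^ k) (T U) (T v) => p q' TU Tv; clin.
have h1 : `|lam ^ k *: (v - c ^ k *: U)|m <= K *: gap t c z.
  by rewrite modulus_unimodular ?hv // normcX_int.
have h2 : `|b ^ k *: ((u - P u, 0) : EC)|m <= d.
  rewrite modulus_unimodular ?normcX_int // modulus_real vabs_le.
  by rewrite -(opprB (P u)) leN_vabs opprK le_vabs.
have h3 : `|T (v - b ^ k *: U)|m <= K *: P (gap t b z).
  by apply: (le_trans (T_le _)); rewrite -linearZ; exact/(pos_op_le P_ge0)/hv.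
have h4 : P (gap t b z) <= gap t c z + ((t / 2 + t^-1) *: d + t^-1 *: q).
  have hr : rpart b (lam *: z) = rpart c z.
    rewrite rpartZ /b mulrA; congr rpart.
    have -> : conjc lam * lam = 1.
      move/normc1P: lam1; case: (lam) => l1 l2 /= h.
      by apply/eqP; rewrite eq_complex /=; apply/andP; split; apply/eqP; lra.
    by rewrite mul1r.
  have hq : rpart b (lam *: z - T z) <= q by exact: rpart_le_modulus.
  have hd : P u - u <= d by exact: le_vabs.
  have a0 : 0 <= t / 2 + t^-1 by rewrite addr_ge0 ?divr_ge0 ?invr_ge0 ?ltW.
  have a1 : 0 <= t^-1 by rewrite invr_ge0 ltW.
  rewrite rpartD hr in hq.
  apply: (le_lin2 hd hq a0 a1); rewrite /gap -/u linearB !linearZ /= (op_rpart TE).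
  have -> : rpart b (- T z) = - rpart b (T z) by rewrite /rpart /=; lin.
  by lin.
have h5 := blat_leZ K0 h4.
rewrite e1; apply: (le_trans (modulusD _ _)); rewrite modulusN.
have h6 := modulusD (lam ^ k *: (v - c ^ k *: U)) (b ^ k *: ((u - P u, 0) : EC)).
have h7 := blat_leD h6 (blat_leD (blat_leD h1 h2) (le_trans h3 h5)).
by apply: (le_lin1 h7 ler01); lin.
Qed.

Lemma approx_power_eigenvector lam k e :
  normc lam = 1 -> spectrum T lam -> 0 < e ->
  exists N v, [/\ cplx_norm v <= 2, 1 / 2 <= `|A N `|v|m| &
    `|A N `|lam ^ k *: v - T v|m| <= e].
Proof.
move=> lam1 sp e0; set K : R := (absz k)%:R.
have K0 : 0 <= K by rewrite ler0n.
have K1 : 0 < K + 1 by rewrite ltr_wpDl.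
(* The first bound keeps the modulus of [v] close to that of [z]; the second makes
   the term [2 K t u], which does not shrink with the defects, at most [e / 2]
   under the mean. *)
pose t := Num.min ((4 * (K + 1))^-1) (e / (4 * ((K + 1) * M))).
have t0 : 0 < t by rewrite lt_min invr_gt0 divr_gt0 ?mulr_gt0.
have tK : K * t <= 1 / 4.
  have : t <= (4 * (K + 1))^-1 by rewrite ge_min lexx.
  rewrite -[(4 * _)^-1]mul1r ler_pdivlMr ?mulr_gt0 // => h; have := ltW t0; lra.
have tM : 2 * K * t * M <= e / 2.
  have : t <= e / (4 * ((K + 1) * M)) by rewrite ge_min lexx orbT.
  rewrite ler_pdivlMr ?mulr_gt0 // => h.
  have := mulr_ge0 (ltW t0) M_ge0; lra.
pose s := t / 2 + t^-1.
have s0 : 0 <= s by rewrite addr_ge0 ?divr_ge0 ?invr_ge0 ?ltW.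
have t1 : 0 <= t^-1 by rewrite invr_ge0 ltW.
pose C1 := 1 + 2 * K * s; pose C2 := 2 * K * t^-1.
have C10 : 0 < C1 by rewrite ltr_wpDr // !mulr_ge0.
have C20 : 0 <= C2 by rewrite !mulr_ge0.
have C0 : 0 < C1 + C2 by rewrite ltr_wpDr.
pose e' := e / (2 * (C1 + C2)).
have e'0 : 0 < e' by rewrite divr_gt0 ?mulr_gt0.
have [N [z [z1 hz hq hd]]] := almost_fixed_modulus lam1 sp e'0.
have [v hv] := approx_power k z t0.
have [hv1 hv2] := approx_power_modulus t0 hv; rewrite -/K in hv1 hv2.
set u := `|z|m in hv1 hv2 hz.
have un : `|u| = 1 by [].
have Kt0 : 0 <= K * t by rewrite mulr_ge0 // ltW.
exists N, v; split.
- apply: (le_trans (cplx_norm_le hv1)); rewrite normrZ un ger0_norm; lra.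
- have h := mean_norm_le N (modulus_ge0 z) hv2; rewrite -/u in h.
  have h' := mean_norm_addZ N `|v|m u Kt0.
  have : K * t * `|A N u| <= 1 / 4 * `|A N u| by rewrite ler_wpM2r.
  lra.
set d := vabs _ in hd; set q := `|lam *: z - T z|m in hq.
have hw : `|lam ^ k *: v - T v|m <= C1 *: d + C2 *: q + (2 * K * t) *: u.
  have K20 : 0 <= 2 * (2 * K) by rewrite !mulr_ge0.
  have := sup_gap t0 K20 (fun c c1 => defect_le lam1 t0 c1 hv).
  rewrite -/u -/K -/d -/q => h; apply: (le_lin1 h ler01); rewrite /C1 /C2 /s.
  by lin_setup R E; field; rewrite gt_eqF.
apply: (le_trans (mean_norm_le N (modulus_ge0 _) hw)).
have Kt20 : 0 <= 2 * K * t by rewrite !mulr_ge0 // ltW.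
apply: (le_trans (mean_norm_addZ _ _ _ Kt20)).
have g1 := mean_norm_addZ N (C1 *: d) q C20.
have g0 := mean_norm_addZ N 0 d (ltW C10).
rewrite add0r linear0 normr0 add0r in g0.
have g2 := ler_wpM2l (ltW C10) hd; have g3 := ler_wpM2l C20 hq.
have g4 := ler_wpM2l Kt20 (mean_bound P_bound N u).
rewrite un mulr1 in g4.
have g5 : (C1 + C2) * e' = e / 2.
  by rewrite /e'; field; rewrite gt_eqF.
lra.
Qed.

(** The correction by [e mu S v] replaces the equation at [mu] by one at
    [(1 + e) mu], where the means obey [subeigen_bound], at the price of a right
    side changed only to second order in [e]. *)
Lemma resolvent_mean_bound mu (S : EC -> EC) K e N v :
  normc mu = 1 -> 0 <= K -> 0 < e ->
  (forall z, mu *: S z - T (S z) = z) ->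
  (forall z, cplx_norm (S z) <= K * cplx_norm z) ->
  `|A N `|v|m| <= M / e * `|A N `|mu *: v - T v|m| +
    e * (M * K * (M + 1)) * cplx_norm v.
Proof.
move=> mu1 K0 e0 hS SK.
set w := mu *: v - T v; set r := S v.
have rn : `|A N `|r|m| <= M * (K * cplx_norm v).
  by apply: (le_trans (mean_bound P_bound N _)); rewrite ler_wpM2l // SK.
pose x := v - (e%:C * mu) *: r.
pose g := w - (e%:C * mu) ^+ 2 *: r.
have e1 : 0 < 1 + e by rewrite addr_gt0.
have en : normc (e%:C * mu) = e by rewrite normcM normc_real mu1 mulr1 gtr0_norm.
have hx : ((1 + e)%:C * mu) *: x = T x + g.
  have Tr : T r = mu *: r - v by have h := hS v; rewrite -[in RHS]h -/r; clin.
  rewrite /x /g /w [T (v - _)]linearB [T (_ *: _)]linearZ /= Tr rmorphD rmorph1; clin.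
have hxm : (1 + e) *: `|x|m <= P `|x|m + `|g|m.
  have <- : normc ((1 + e)%:C * mu) = 1 + e.
    by rewrite normcM normc_real mu1 mulr1 gtr0_norm.
  rewrite -modulusZ hx; apply: (le_trans (modulusD _ _)).
  by apply: blat_leD => //; exact: T_le.
have ha : `|A N `|x|m| <= M / e * `|A N `|g|m|.
  apply: (subeigen_bound P_ge0 M_ge1 P_bound e0).
    exact/mean_ge0/modulus_ge0/P_ge0.
  by rewrite -mean_comm -linearZ -linearD; exact: mean_le.
have hg : `|A N `|g|m| <= `|A N `|w|m| + e ^+ 2 * `|A N `|r|m|.
  have h : `|g|m <= `|w|m + e ^+ 2 *: `|r|m.
    rewrite /g; apply: (le_trans (modulusD _ _)).
    by rewrite modulusN modulusZ expr2 normcM en -expr2.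
  apply: (le_trans (mean_norm_le N (modulus_ge0 _) h)).
  by apply: mean_norm_addZ; rewrite sqr_ge0.
have hv : `|A N `|v|m| <= `|A N `|x|m| + e * `|A N `|r|m|.
  have h : `|v|m <= `|x|m + e *: `|r|m.
    rewrite -{1}(subrK ((e%:C * mu) *: r) v) -/x.
    by apply: (le_trans (modulusD _ _)); rewrite modulusZ en.
  apply: (le_trans (mean_norm_le N (modulus_ge0 _) h)).
  exact: mean_norm_addZ (ltW e0).
have Me : 0 <= M / e by rewrite divr_ge0 // ltW.
have h1 := ler_wpM2l Me hg; have h2 := ler_wpM2l (ltW e0) rn.
have h3 := ler_wpM2l M_ge0 h2.
have h4 : M / e * (e ^+ 2 * `|A N `|r|m|) = M * (e * `|A N `|r|m|).
  by field; rewrite gt_eqF.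
lra.
Qed.

Lemma spectrum_power lam k : normc lam = 1 -> spectrum T lam ->
  spectrum T (lam ^ k).
Proof.
move=> lam1 sp [S [Sfin _ hS]].
have [K K0 SK] := op_norm_lty_bound (fun d z => linearZ_LR S d z) Sfin.
have L0 : 0 < M * K * (M + 1) + 1.
  by rewrite ltr_wpDl // !mulr_ge0 // addr_ge0.
(* With these choices the two terms of [resolvent_mean_bound] are at most [1 / 8]
   and [1 / 4], whereas their sum is at least [1 / 2]. *)
pose e := (8 * (M * K * (M + 1) + 1))^-1.
have e0 : 0 < e by rewrite invr_gt0 mulr_gt0.
have eL : e * (M * K * (M + 1)) <= 1 / 8.
  have : e * (8 * (M * K * (M + 1) + 1)) = 1 by rewrite mulVf // gt_eqF // mulr_gt0.
  have := ltW e0; lra.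
have d0 : 0 < e / (8 * M) by rewrite divr_gt0 // mulr_gt0.
have [N [v [v2 hv hw]]] := approx_power_eigenvector k lam1 sp d0.
have := resolvent_mean_bound N v (normcX_int k lam1) K0 e0 hS SK.
have Me : 0 <= M / e by rewrite divr_ge0 // ltW.
have := ler_wpM2l Me hw.
have -> : M / e * (e / (8 * M)) = 1 / 8.
  by field; rewrite !gt_eqF.
have : e * (M * K * (M + 1)) * cplx_norm v <= 1 / 8 * 2.
  by apply: ler_pM => //; rewrite ?cplx_norm_ge0 // !mulr_ge0 ?addr_ge0 // ltW.
lra.
Qed.

End Cyclicity.

Theorem theorem3p2 (R : realType) (E : banachLatticeType R)
    (T : {linear complexification E -> complexification E}) :
  power_bounded T -> positive_op T ->
  forall lam : R[i], spectrum T lam -> `|lam| = 1 ->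
  forall k : int, spectrum T (lam ^ k).
Proof.
move=> /power_bound[M M1 TM] Tpos lam sp lam1 k.
have nlam : normc lam = 1.
  by move: lam1; rewrite normr_normc => -[].
exact: (@spectrum_power R E T (real_op T) M (real_opE Tpos)
  (real_op_ge0 Tpos) M1 TM lam k nlam sp).
Qed.
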